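(* Let $n\ge 2$, $\alpha\le 0$ and $\beta\ge 0$. Let $$\gamma_{n,\alpha}:=\left(\frac{n-2}{2}\right)^2-\left(\frac{\alpha-2}{2}\right)^2,\qquad \mu_{n,\alpha}:=\min_{j\in\mathbb{N}\cup\{0\}}|\gamma_{n,\alpha}+j(n-2+j)|^2,$$ and suppose that $\mu_{n,\alpha}=0$. Then there exists $R>1$ large enough such that $$2\bar\gamma_{n,\alpha}\left(\frac{\beta+1}{2}\right)^2\int_{\mathbb{R}^n\setminus\overline B_R}\frac{|x|^{\alpha-4}\varphi^2}{(\log|x|)^{\beta+2}}\,dx\le\int_{\mathbb{R}^n\setminus\overline B_R}\frac{|x|^{\alpha}|\Delta\varphi|^2}{(\log|x|)^{\beta}}\,dx\qquad\text{for any }\varphi\in C^\infty_c(\mathbb{R}^n\setminus\overline B_R),$$ with $\bar\gamma_{n,\alpha}:=\left(\frac{n-2}{2}\right)^2+\left(\frac{\alpha-2}{2}\right)^2$.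
   Context: $B_R$ denotes the open ball in $\mathbb{R}^n$ of radius $R$ centered at the origin; $n$ is an integer and $\alpha,\beta$ are real. $C^\infty_c(\Omega)$ is the set of smooth functions with support compactly contained in the open set $\Omega$. *)

(* Defs.v *)
From HB Require Import structures.
From mathcomp Require Import all_boot all_order all_algebra.
From mathcomp Require Import all_classical all_reals all_analysis.

Set Implicit Arguments.
Unset Strict Implicit.
Unset Printing Implicit Defensive.
Import Order.TTheory GRing.Theory Num.Theory.
Import numFieldNormedType.Exports.
Local Open Scope classical_set_scope.
Local Open Scope ring_scope.

(* The product sigma-algebra on row vectors, as for n-tuples in the library; for
   T = R it is the Borel sigma-algebra of R^n. *)
Section measurable_rV.
Context d (T : measurableType d) (n : nat).

Let coord : 'I_n -> 'rV[T]_n -> T := fun i x => x ord0 i.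

Let rV_set0 : g_sigma_preimage coord set0.
Proof. exact: sigma_algebra0. Qed.

Let rV_setC A : g_sigma_preimage coord A -> g_sigma_preimage coord (~` A).
Proof. exact: sigma_algebraC. Qed.

Let rV_bigcup (F : _^nat) : (forall i, g_sigma_preimage coord (F i)) ->
  g_sigma_preimage coord (\bigcup_i (F i)).
Proof. exact: sigma_algebra_bigcup. Qed.

HB.instance Definition _ := @isMeasurable.Build d
  'rV[T]_n (g_sigma_preimage coord) rV_set0 rV_setC rV_bigcup.

End measurable_rV.

Lemma measurable_coord d (T : measurableType d) n (i : 'I_n) :
  measurable_fun [set: 'rV[T]_n] (fun x => x ord0 i).
Proof.
move=> _ Y mY; rewrite setTI; apply: sub_sigma_algebra => /=.
rewrite -bigcup_seq/=; exists i => /=; first by rewrite mem_index_enum.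
by exists Y => //; rewrite setTI.
Qed.

Lemma measurable_fun_rVP d d' (S : measurableType d) (T : measurableType d') n
    (f : S -> 'rV[T]_n) :
  measurable_fun [set: S] f <->
  forall i, measurable_fun [set: S] (fun x => f x ord0 i).
Proof.
split=> [mf i|mf].
  exact: (measurableT_comp (measurable_coord i) mf).
move=> _ A mA; rewrite setTI.
suff : preimage_set_system [set: S] f measurable `<=` measurable.
  by apply; exists A => //; rewrite setTI.
rewrite /measurable/= -g_sigma_preimage_comp.
apply: smallest_sub; first exact: sigma_algebra_measurable.
rewrite -bigcup_seq/=; apply: bigcup_sub => i _ B [C mC <-].
exact: mf.
Qed.

Section lebesgue_rV.
Context (R : realType).

Definition cons_rV n (p : measurableTypeR R * 'rV[R]_n) : 'rV[R]_n.+1 :=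
  row_mx (const_mx p.1 : 'rV[R]_1) p.2.

Lemma cons_rV0 n p : @cons_rV n p ord0 ord0 = p.1.
Proof.
rewrite /cons_rV (_ : ord0 = lshift n (ord0 : 'I_1)); last exact/val_inj.
by rewrite (@row_mxEl _ 1 1 n) mxE.
Qed.

Lemma cons_rVS n p j : @cons_rV n p ord0 (lift ord0 j) = p.2 ord0 j.
Proof.
rewrite /cons_rV (_ : lift ord0 j = rshift 1 j); last exact/val_inj.
by rewrite (@row_mxEr _ 1 1 n).
Qed.

Lemma measurable_cons_rV n : measurable_fun setT (@cons_rV n).
Proof.
apply/measurable_fun_rVP => i; have [j ->|->] := unliftP ord0 i.
  under eq_fun do rewrite cons_rVS.
  exact: (measurableT_comp (measurable_coord j) measurable_snd).
by under eq_fun do rewrite cons_rV0; exact: measurable_fst.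
Qed.

Section step.
Local Open Scope ereal_scope.
Variables (n : nat) (mu : {sigma_finite_measure set 'rV[R]_n -> \bar R}).

Definition lebesgue_cons : set 'rV[R]_n.+1 -> \bar R :=
  pushforward (lebesgue_measure \x mu) (@cons_rV n).

Let lebesgue_cons0 : lebesgue_cons set0 = 0.
Proof. by rewrite /lebesgue_cons /pushforward preimage_set0 measure0. Qed.

Let lebesgue_cons_ge0 A : 0 <= lebesgue_cons A.
Proof. by rewrite /lebesgue_cons /pushforward measure_ge0. Qed.

Let lebesgue_cons_sigma_additive : semi_sigma_additive lebesgue_cons.
Proof.
move=> F mF tF mUF; rewrite /lebesgue_cons /pushforward preimage_bigcup.
have mf A : measurable A -> measurable (@cons_rV n @^-1` A).
  by move=> mA; rewrite -[X in measurable X]setTI; exact: measurable_cons_rV.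
apply: measure_semi_sigma_additive.
- by move=> i; exact: mf.
- apply/trivIsetP => /= i j _ _ ij; rewrite -preimage_setI.
  by move/trivIsetP : tF => /(_ _ _ _ _ ij) ->//; rewrite preimage_set0.
- by rewrite -preimage_bigcup; exact: mf.
Qed.

HB.instance Definition _ := isMeasure.Build _ _ _ lebesgue_cons
  lebesgue_cons0 lebesgue_cons_ge0 lebesgue_cons_sigma_additive.

Let lebesgue_cons_sigma_finite : sigma_finite setT lebesgue_cons.
Proof.
have /sigma_finiteP[F [TF ndF Foo]] := sigma_finiteT (@lebesgue_measure R).
have /sigma_finiteP[G [TG ndG Goo]] := sigma_finiteT mu.
pose cut (x : 'rV[R]_n.+1) : measurableTypeR R * 'rV[R]_n :=
  (x ord0 ord0, \row_j x ord0 (lift ord0 j)).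
have consK : cancel (@cons_rV n) cut.
  move=> [a v]; rewrite /cut cons_rV0; congr pair.
  by apply/rowP => j; rewrite mxE cons_rVS.
have mcut : measurable_fun setT cut.
  apply: measurable_fun_pair; first exact: measurable_coord.
  apply/measurable_fun_rVP => i; under eq_fun do rewrite mxE.
  exact: measurable_coord.
exists (fun i => cut @^-1` (F i `*` G i)).
  rewrite -preimage_bigcup -(preimage_setT cut); congr (_ @^-1` _).
  rewrite -setXTT TF TG predeqE => -[x y]; split.
    move=> [/= [i _ Fix] [k _ Gky]]; exists (maxn i k) => //; split.
    - by move: x Fix; exact/subsetPset/ndF/leq_maxl.
    - by move: y Gky; exact/subsetPset/ndG/leq_maxr.
  by move=> [i _ []/= ? ?]; split; exists i.
move=> i; have [mF Fi] := Foo i; have [mG Gi] := Goo i; split.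
  by rewrite -[X in measurable X]setTI; apply: mcut => //; exact: measurableX.
rewrite /lebesgue_cons /pushforward -comp_preimage.
rewrite (_ : cut \o _ = id); last by apply/funext => p /=; rewrite consK.
by rewrite preimage_id product_measure1E// lte_mul_pinfty// ge0_fin_numE.
Qed.

HB.instance Definition _ := Measure_isSigmaFinite.Build _ _ _ lebesgue_cons
  lebesgue_cons_sigma_finite.

End step.

(* The n-fold product of the one-dimensional Lebesgue measure. *)
Fixpoint lebesgue_rV n : {sigma_finite_measure set 'rV[R]_n -> \bar R} :=
  if n is n'.+1 then lebesgue_cons (lebesgue_rV n') else \d_ (0 : 'rV[R]_0).

Lemma lebesgue_rV_box n (a b : 'rV[R]_n) : (forall i, a ord0 i <= b ord0 i) ->
  lebesgue_rV n [set x | forall i, x ord0 i \in `[a ord0 i, b ord0 i]] =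
  (\prod_i (b ord0 i - a ord0 i))%:E.
Proof.
elim: n a b => [|n IH] a b ab.
  rewrite big_ord0 /= diracE mem_set//= => -[]//.
pose a' := \row_j a ord0 (lift ord0 j) : 'rV[R]_n.
pose b' := \row_j b ord0 (lift ord0 j) : 'rV[R]_n.
rewrite [LHS]/= /lebesgue_cons /pushforward.
pose B := [set x : 'rV[R]_n | forall i, x ord0 i \in `[a' ord0 i, b' ord0 i]].
have mB : measurable B.
  rewrite (_ : B = \bigcap_(i in [set: 'I_n])
     ((fun x => x ord0 i) @^-1` `[a' ord0 i, b' ord0 i])); last first.
    by apply/seteqP; split => x /= Bx i; [move=> _|]; exact: Bx.
  apply: fin_bigcap_measurable => // i _.
  rewrite -[X in measurable X]setTI; apply: measurable_coord => //.
rewrite (_ : _ @^-1` _ = [set` `[a ord0 ord0, b ord0 ord0]] `*` B); last first.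
  apply/seteqP; split => -[x v] /= H.
    split; first by have := H ord0; rewrite cons_rV0.
    by move=> i /=; have := H (lift ord0 i); rewrite cons_rVS !mxE.
  move=> i; have [j ->|->] := unliftP ord0 i.
    by rewrite cons_rVS; have := H.2 j; rewrite !mxE.
  by rewrite cons_rV0; exact: H.1.
rewrite product_measure1E//= IH; last by move=> i; rewrite !mxE.
rewrite lebesgue_measure_itv/= big_ord_recl EFinM; congr (_ * _)%E.
  rewrite lte_fin; case: ltgtP (ab ord0) => // -> _; by rewrite subrr.
by congr EFin; apply: eq_bigr => i _; rewrite !mxE.
Qed.

End lebesgue_rV.

Section calculus.
Context (R : realType) (n : nat).
Implicit Types (f : 'rV[R]_n -> R) (x : 'rV[R]_n).

(* The norm that the library puts on matrices is the sup norm. *)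
Definition euclid x : R := Num.sqrt (\sum_i x ord0 i ^+ 2).

Definition euclid_ball (r : R) : set 'rV[R]_n := [set x | euclid x < r].

Definition partial (i : 'I_n) f : 'rV[R]_n -> R :=
  fun x => 'D_(delta_mx ord0 i) f x.

Definition iter_partial (s : seq 'I_n) f : 'rV[R]_n -> R := foldr partial f s.

(* C^oo : the partial derivatives of all orders exist and are continuous. *)
Definition smooth f := forall s : seq 'I_n,
  continuous (iter_partial s f) /\
  forall i x, derivable (iter_partial s f) x (delta_mx ord0 i).

Definition laplacian f : 'rV[R]_n -> R :=
  fun x => \sum_i partial i (partial i f) x.

Definition supp f : set 'rV[R]_n := closure [set x | f x != 0].

(* C^oo_c(U), an element being identified with its extension by 0 to R^n. *)
Definition test_function (U : set 'rV[R]_n) f :=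
  [/\ smooth f, compact (supp f) & supp f `<=` U].

End calculus.

Section constants.
Context (R : realType).
Implicit Types (n : nat) (alpha : R).

Definition gamma_na n alpha : R :=
  ((n%:R - 2) / 2) ^+ 2 - ((alpha - 2) / 2) ^+ 2.

Definition gamma_bar_na n alpha : R :=
  ((n%:R - 2) / 2) ^+ 2 + ((alpha - 2) / 2) ^+ 2.

Definition mu_na_set n alpha : set R :=
  [set `|gamma_na n alpha + j%:R * (n%:R - 2 + j%:R)| ^+ 2 | j in [set: nat]].

(* The infimum is a minimum: see mu_na_min below. *)
Definition mu_na n alpha : R := inf (mu_na_set n alpha).

Lemma mu_na_min n alpha : (2 <= n)%N ->
  mu_na_set n alpha (mu_na n alpha) /\ lbound (mu_na_set n alpha) (mu_na n alpha).
Proof.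
move=> n2.
pose c (j : nat) : R := gamma_na n alpha + j%:R * (n%:R - 2 + j%:R).
have cE j : `|c j| ^+ 2 = c j ^+ 2 by rewrite real_normK// num_real.
have n2R : 0 <= n%:R - 2 :> R by rewrite subr_ge0 (ler_nat _ 2).
pose N := (Num.truncn (`|gamma_na n alpha| + `|gamma_na n alpha|)).+1.
have HN j : (N <= j)%N -> `|c 0| <= `|c j|.
  move=> Nj.
  have gj : `|gamma_na n alpha| + `|gamma_na n alpha| <= j%:R.
    apply: (@le_trans _ _ N%:R); last by rewrite ler_nat.
    by rewrite ltW// truncnS_gt.
  rewrite {1}/c mul0r addr0.
  have j1 : 1 <= j%:R :> R by rewrite (ler_nat _ 1); exact: leq_trans Nj.
  have jj : j%:R <= j%:R * (n%:R - 2 + j%:R) :> R.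
    by rewrite ler_peMr// ?(le_trans ler01)// -[leLHS]add0r lerD.
  rewrite (le_trans _ (ler_norm _))// /c.
  have := ler_norm (- gamma_na n alpha); rewrite normrN => ?.
  by rewrite -lerBlDl (le_trans _ jj)// (le_trans _ gj)// lerD.
pose k := [arg min_(i < (ord0 : 'I_N.+1)) `|c i|]%O.
have kmin j : `|c k| <= `|c j|.
  rewrite /k; case: arg_minP => //= i _ Hi.
  have [Nj|jN] := leqP N j.
    by rewrite (le_trans (Hi ord0 isT))//; exact: HN.
  have jN' : (j < N.+1)%N by exact: ltnW.
  exact: (Hi (Ordinal jN') isT).
have lbk : lbound (mu_na_set n alpha) (`|c k| ^+ 2).
  move=> _ [j _ <-]; apply: lerXn2r; rewrite ?nnegrE//; exact: kmin.
have muk : mu_na n alpha = `|c k| ^+ 2.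
  apply/eqP; rewrite eq_le; apply/andP; split.
    apply: ge_inf; first by exists (`|c k| ^+ 2).
    by exists (k : nat).
  apply: lb_le_inf => //; by exists (`|c k| ^+ 2); exists (k : nat).
by rewrite muk; split => //; exists (k : nat).
Qed.

End constants.

(* Main.v *)
Require Import Defs.
From mathcomp Require Import all_boot all_order all_algebra.
From mathcomp Require Import all_classical all_reals all_analysis.
From mathcomp Require Import measurable_realfun ring lra.
Import Order.TTheory GRing.Theory Num.Theory.
Import numFieldNormedType.Exports.
Local Open Scope classical_set_scope.
Local Open Scope ring_scope.

(* Write phi = |x|^(m+1-n/2) w with m = 1 - alpha/2, t = log |x|, E = x . grad = d/dt
   and C the positive Laplacian of the unit sphere.  Then |x|^2 Delta becomes
   E^2 + 2 m E - A with A = C + gamma, and both integrals are taken against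
   |x|^(-n) dx = dt d(theta).  Expanding the square and integrating by parts gives

     int t^(-beta) (E^2 w + 2 m E w - A w)^2
       >= (4 m^2 + 2 gamma) int t^(-beta) (E w)^2
          + int t^(-beta) ((A w)^2 - h(t) w A w),

   with h(t) = 2 m beta / t + beta (beta + 1) / t^2.  Here 4 m^2 + 2 gamma is
   2 gamma_bar, and Hardy's inequality in t bounds the first term below by the
   claimed left-hand side.  Since mu = 0, gamma = - c_j for some eigenvalue
   c_j = j (n-2+j) of C, so every eigenvalue lambda of A satisfies
   lambda (lambda - 1) >= 0; hence the last integral is nonnegative as soon as
   h(t) <= 1, which fixes R.

   No polar coordinates are needed: E and C are differential operators on R^n, C is
   symmetric for radial weights, and the gap passes from polynomials (finite sums of
   eigenfunctions of C) to test functions by L^2 density alone, because the form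
   A^2 - A is bounded below by -1/4. *)

(** The two halves of 2 gamma_bar have different origins. The square of 2 m E w gives 4 m^2, while 2
    gamma comes from the cross term - 2 E^2 w A w: up to lower weights it integrates to 2 (E w) A (E
    w), which is at least 2 gamma (E w)^2 because C >= 0. Moving derivatives across t^(-beta) leaves
    the two parts of h: - 4 m E w A w gives 2 m beta / t, and - 2 E^2 w A w gives beta (beta + 1) /
    t^2. The terms (E^2 w)^2 and 4 m E^2 w E w have nonnegative integrals and are dropped. The
    obstacle is that for mu = 0 the operator A has the eigenvalue 0. On that component A w vanishes,
    and any bound must come from the derivatives of w in t; hence the logarithmic weights. *)

Set Implicit Arguments.
Unset Strict Implicit.
Unset Printing Implicit Defensive.

(** * Smooth functions on open sets *)

Section smooth_calculus.
Context (R : realType) (n : nat).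
Implicit Types (f g u v : 'rV[R]_n -> R) (x y : 'rV[R]_n) (U V : set 'rV[R]_n).

Let e (i : 'I_n) : 'rV[R]_n := delta_mx ord0 i.

(** [smooth] is a condition on all of R^n, but powers of |x| and of log |x| are smooth only away
    from their singularities. This is a version local to U, recursive in the order so that closure
    properties go by induction. *)
Fixpoint Ck (k : nat) U f : Prop :=
  match k with
  | 0 => forall x, U x -> {for x, continuous f}
  | k'.+1 => [/\ forall x, U x -> {for x, continuous f},
                forall i x, U x -> derivable f x (delta_mx ord0 i) &
                forall i, Ck k' U (partial i f)]
  end.

Definition smooth_on U f := forall k, Ck k U f.

Lemma near_open_eq U f g x : open U -> U x -> {in U, f =1 g} ->
  {near x, f =1 g}.
Proof.
move=> oU Ux fg; apply: filterS (open_nbhs_nbhs (conj oU Ux)) => y Uy.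
by apply: fg; rewrite inE.
Qed.

Lemma partial_near_eq U i f g x : open U -> U x -> {in U, f =1 g} ->
  partial i f x = partial i g x.
Proof.
by move=> oU Ux fg; exact: near_eq_derive (near_open_eq oU Ux fg).
Qed.

Lemma derivable_near_eq U i f g x : open U -> U x -> {in U, f =1 g} ->
  derivable f x (delta_mx ord0 i) -> derivable g x (delta_mx ord0 i).
Proof.
by move=> oU Ux fg; exact: near_eq_derivable (near_open_eq oU Ux fg).
Qed.

Lemma continuous_near_eq U f g x : open U -> U x -> {in U, f =1 g} ->
  {for x, continuous f} -> {for x, continuous g}.
Proof.
move=> oU Ux fg cf; rewrite /prop_for /continuous_at -(fg x) ?inE//.
apply: cvg_trans cf; exact: near_eq_cvg (near_open_eq oU Ux fg).
Qed.

Lemma Ck_eq k U f g : open U -> {in U, f =1 g} -> Ck k U f -> Ck k U g.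
Proof.
move=> oU; elim: k f g => [|k IH] f g fg /=.
  by move=> cf x Ux; apply: (continuous_near_eq oU Ux fg); exact: cf.
move=> [cf df Cf]; split.
- by move=> x Ux; apply: (continuous_near_eq oU Ux fg); exact: cf.
- by move=> i x Ux; apply: (derivable_near_eq oU Ux fg); exact: df.
- move=> i; apply: (IH (partial i f)) => // x; rewrite inE => Ux.
  exact: (partial_near_eq _ oU Ux fg).
Qed.

Lemma CkW k U f : Ck k.+1 U f -> Ck k U f.
Proof.
elim: k f => [|k IH] f; first by case.
move=> [cf df Cf]; split => // i; apply: IH; exact: Cf.
Qed.

Lemma Ck_sub k U V f : V `<=` U -> Ck k U f -> Ck k V f.
Proof.
move=> VU; elim: k f => [|k IH] f /=; first by move=> cf x Vx; exact/cf/VU.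
by move=> [cf df Cf]; split=> [x Vx|i x Vx|i]; [exact/cf/VU|exact/df/VU|exact: IH].
Qed.

Lemma CkU k U V f : Ck k U f -> Ck k V f -> Ck k (U `|` V) f.
Proof.
elim: k f => [|k IH] f /=; first by move=> cf cg x [Ux|Vx]; [exact: cf|exact: cg].
move=> [cf df Cf] [cg dg Cg]; split=> [x [Ux|Vx]|i x [Ux|Vx]|i].
- exact: cf.
- exact: cg.
- exact: df.
- exact: dg.
- exact: IH.
Qed.

Lemma partial_cst i c x : partial i (fun=> c) x = 0.
Proof. exact: derive_cst. Qed.

Lemma partialD i f g x : derivable f x (e i) -> derivable g x (e i) ->
  partial i (fun x => f x + g x) x = partial i f x + partial i g x.
Proof. exact: deriveD. Qed.

Lemma partialM i f g x : derivable f x (e i) -> derivable g x (e i) ->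
  partial i (fun x => f x * g x) x = partial i f x * g x + f x * partial i g x.
Proof.
by move=> df dg; rewrite /partial deriveM// addrC /GRing.scale/= [g x * _]mulrC.
Qed.

Lemma Ck_cst k U c : Ck k U (fun=> c).
Proof.
elim: k c => [|k IH] c /=; first by move=> x _; exact: cst_continuous.
split => [x _|i x _|i]; first exact: cst_continuous.
  exact: derivable_cst.
rewrite (_ : partial i _ = fun=> 0) //.
by apply/funext => x; rewrite partial_cst.
Qed.

Lemma is_derive_coord (i j : 'I_n) x :
  is_derive x (e i) (fun y => y ord0 j) (i == j)%:R.
Proof.
have dc : differentiable (fun y : 'rV[R]_n => y ord0 j) x.
  exact: differentiable_coord.
split; first exact: diff_derivable.
rewrite /derive; apply: cvg_lim => //.
apply: cvg_near_cst; near=> h; apply/eqP.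
rewrite /= !mxE addrK eqxx/= /GRing.scale/= mulrA mulVf ?mul1r;
  first by rewrite [i == j]eq_sym.
near: h; exact: nbhs_dnbhs_neq.
Unshelve. all: by end_near. Qed.

Lemma partial_coord i j x : partial i (fun y => y ord0 j) x = (i == j)%:R.
Proof. exact: (@derive_val _ _ _ _ _ _ _ (is_derive_coord i j x)). Qed.

Lemma continuous_coord j : continuous (fun y : 'rV[R]_n => y ord0 j).
Proof. by move=> x; apply: differentiable_continuous; exact: differentiable_coord. Qed.

Lemma Ck_coord k U j : Ck k U (fun y => y ord0 j).
Proof.
case: k => [|k] /=; first by move=> x _; exact: continuous_coord.
split => [x _|i x _|i]; first exact: continuous_coord.
  exact: (@ex_derive _ _ _ _ _ _ _ (is_derive_coord i j x)).
rewrite (_ : partial i _ = fun=> (i == j)%:R); first exact: Ck_cst.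
by apply/funext => x; rewrite partial_coord.
Qed.

Lemma CkD k U f g : open U -> Ck k U f -> Ck k U g -> Ck k U (fun x => f x + g x).
Proof.
move=> oU; elim: k f g => [|k IH] f g /=.
  by move=> cf cg x Ux; exact: (cvgD (cf x Ux) (cg x Ux)).
move=> [cf df Cf] [cg dg Cg]; split => [x Ux|i x Ux|i].
- exact: (cvgD (cf x Ux) (cg x Ux)).
- exact: (derivableD (df i x Ux) (dg i x Ux)).
- apply: (@Ck_eq _ _ (fun x => partial i f x + partial i g x)) => //.
    by move=> x; rewrite inE => Ux; rewrite partialD//; [exact: df|exact: dg].
  exact: IH.
Qed.

Lemma CkM k U f g : open U -> Ck k U f -> Ck k U g -> Ck k U (fun x => f x * g x).
Proof.
move=> oU; elim: k f g => [|k IH] f g.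
  by move=> cf cg x Ux; exact: (cvgM (cf x Ux) (cg x Ux)).
move=> kf kg; have [cf df Cf] := kf; have [cg dg Cg] := kg.
split => [x Ux|i x Ux|i].
- exact: (cvgM (cf x Ux) (cg x Ux)).
- exact: (derivableM (df i x Ux) (dg i x Ux)).
- apply: (@Ck_eq _ _ (fun x => partial i f x * g x + f x * partial i g x)) => //.
    by move=> x; rewrite inE => Ux; rewrite partialM//; [exact: df|exact: dg].
  by apply: CkD => //; apply: IH; 
    do ?[exact: Cf | exact: Cg | exact: CkW kf | exact: CkW kg].
Qed.

Lemma smooth_on_eq U f g : open U -> {in U, f =1 g} -> smooth_on U f -> smooth_on U g.
Proof. by move=> oU fg sf k; exact: (Ck_eq oU fg (sf k)). Qed.

Lemma smooth_on_sub U V f : V `<=` U -> smooth_on U f -> smooth_on V f.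
Proof. by move=> VU sf k; exact: (Ck_sub VU (sf k)). Qed.

Lemma smooth_onU U V f : smooth_on U f -> smooth_on V f -> smooth_on (U `|` V) f.
Proof. by move=> sf sg k; exact: CkU. Qed.

Lemma smooth_on_cst U c : smooth_on U (fun=> c).
Proof. by move=> k; exact: Ck_cst. Qed.

Lemma smooth_on_coord U j : smooth_on U (fun y => y ord0 j).
Proof. by move=> k; exact: Ck_coord. Qed.

Lemma smooth_onD U f g : open U -> smooth_on U f -> smooth_on U g ->
  smooth_on U (fun x => f x + g x).
Proof. by move=> oU sf sg k; exact: CkD. Qed.

Lemma smooth_onM U f g : open U -> smooth_on U f -> smooth_on U g ->
  smooth_on U (fun x => f x * g x).
Proof. by move=> oU sf sg k; exact: CkM. Qed.

Lemma smooth_onN U f : open U -> smooth_on U f -> smooth_on U (fun x => - f x).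
Proof.
move=> oU sf; rewrite (_ : (fun x => - f x) = (fun x => -1 * f x)).
  by apply: smooth_onM => //; exact: smooth_on_cst.
by apply/funext => x; rewrite mulN1r.
Qed.

Lemma smooth_onB U f g : open U -> smooth_on U f -> smooth_on U g ->
  smooth_on U (fun x => f x - g x).
Proof. by move=> oU sf sg; apply: smooth_onD => //; exact: smooth_onN. Qed.

Lemma smooth_on_sum (I : Type) (r : seq I) U (F : I -> 'rV[R]_n -> R) :
  open U -> (forall i, smooth_on U (F i)) -> smooth_on U (fun x => \sum_(i <- r) F i x).
Proof.
move=> oU sF; elim: r => [|a r IH].
  by under eq_fun do rewrite big_nil; exact: smooth_on_cst.
by under eq_fun do rewrite big_cons; exact: smooth_onD.
Qed.

Lemma smooth_on_partial U f i : smooth_on U f -> smooth_on U (partial i f).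
Proof. by move=> sf k; have [_ _ pf] := sf k.+1; exact: pf. Qed.

Lemma smooth_on_continuous U f x : smooth_on U f -> U x -> {for x, continuous f}.
Proof. by move=> sf Ux; exact: (sf 0%N). Qed.

Lemma smooth_on_derivable U f i x : smooth_on U f -> U x ->
  derivable f x (delta_mx ord0 i).
Proof. by move=> sf Ux; have [_ df _] := sf 1%N; exact: df. Qed.
Arguments smooth_on_derivable [U f] i [x] _ _.

(** Transports a partial derivative to the line through x, where the one-variable chain rule, mean
    value theorem and fundamental theorem of calculus apply. *)
Lemma partial_shift i f x d :
  is_derive x (e i) f d <-> is_derive (0 : R) 1 (fun t : R => f (t *: e i + x)) d.
Proof.
have H : (fun h : R => h^-1 *: (f (h *: e i + x) - f x)) =
         (fun h : R => h^-1 *: (f ((h *: 1 + 0) *: e i + x) - f (0 *: e i + x))).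
  apply/funext => h; congr (_ *: (f (_ *: _ + _) - f _)).
    by rewrite addr0 /GRing.scale/= mulr1.
  by rewrite scale0r add0r.
by split => -[df Df]; split; rewrite /derivable /derive -?H in df Df *; rewrite ?H in df Df *.
Qed.

Lemma is_derive_translate (F : R -> R) (t d : R) :
  is_derive (0 : R) 1 (fun s : R => F (s + t)) d -> is_derive t 1 F d.
Proof.
have H : (fun h : R => h^-1 *: (F (h *: 1 + 0 + t) - F (0 + t))) =
         (fun h : R => h^-1 *: (F (h *: 1 + t) - F t)).
  by apply/funext => h; rewrite addr0 add0r.
by move=> -[df Df]; split; rewrite /derivable /derive -?H in df Df *; rewrite ?H in df Df *.
Qed.

Lemma is_derive_partial_comp (F : R -> R) dF i u x :
  derivable u x (e i) -> is_derive (u x) 1 F dF ->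
  is_derive x (e i) (fun y => F (u y)) (dF * partial i u x).
Proof.
move=> du hF; apply/partial_shift.
have /partial_shift hu : is_derive x (e i) u (partial i u x) by exact: derivableP.
have hF' : is_derive ((fun t : R => u (t *: e i + x)) 0) 1 F dF.
  by rewrite /= scale0r add0r.
have := @is_derive1_comp _ F (fun t : R => u (t *: e i + x)) 0 _ _ hF' hu.
by [].
Qed.

Lemma partial_powR i u a x : derivable u x (e i) -> 0 < u x ->
  is_derive x (e i) (fun y => u y `^ a) (a * u x `^ (a - 1) * partial i u x).
Proof.
move=> du u0; apply: (@is_derive_partial_comp (fun t => t `^ a)) => //.
exact: is_derive1_powR.
Qed.

Lemma partial_ln i u x : derivable u x (e i) -> 0 < u x ->
  is_derive x (e i) (fun y => ln (u y)) ((u x)^-1 * partial i u x).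
Proof.
move=> du u0; apply: (@is_derive_partial_comp (@ln R)) => //.
exact: is_derive1_ln.
Qed.

Lemma smooth_on_powR U u a : open U -> smooth_on U u -> (forall x, U x -> 0 < u x) ->
  smooth_on U (fun x => u x `^ a).
Proof.
move=> oU su u0.
have c a0 x : U x -> {for x, continuous (fun x => u x `^ a0)}.
  move=> Ux; have cu := smooth_on_continuous su Ux.
  apply: (@continuous_comp _ _ _ u (fun t => t `^ a0)) => //.
  apply: differentiable_continuous; apply/derivable1_diffP.
  exact: (@ex_derive _ _ _ _ _ _ _ (is_derive1_powR a0 (u0 _ Ux))).
(* The exponent is generalized because differentiation lowers it by one. *)
move: a => + k; elim: k => [|k IH] a; first exact: c.
have D i x (Ux : U x) := partial_powR a (smooth_on_derivable i su Ux) (u0 _ Ux).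
split => [x Ux|i x Ux|i].
- exact: c.
- exact: (@ex_derive _ _ _ _ _ _ _ (D i x Ux)).
- apply: (@Ck_eq _ _ (fun x => a * u x `^ (a - 1) * partial i u x)) => //.
    by move=> x; rewrite inE => Ux; rewrite -(@derive_val _ _ _ _ _ _ _ (D i x Ux)).
  apply: CkM => //; last exact: smooth_on_partial.
  by apply: CkM => //; exact: Ck_cst.
Qed.

Lemma smooth_on_ln U u : open U -> smooth_on U u -> (forall x, U x -> 0 < u x) ->
  smooth_on U (fun x => ln (u x)).
Proof.
move=> oU su u0.
have D i x (Ux : U x) := partial_ln (smooth_on_derivable i su Ux) (u0 _ Ux).
have c x : U x -> {for x, continuous (fun x => ln (u x))}.
  move=> Ux; have cu := smooth_on_continuous su Ux.
  apply: (@continuous_comp _ _ _ u (@ln R)) => //.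
  by apply: continuous_ln; exact: u0.
case=> [//|k]; split => // [i x Ux|i].
  exact: (@ex_derive _ _ _ _ _ _ _ (D i x Ux)).
apply: (@Ck_eq _ _ (fun x => u x `^ (-1) * partial i u x)) => //.
  move=> x; rewrite inE => Ux; rewrite powR_inv1 ?ltW ?u0//.
  by rewrite -(@derive_val _ _ _ _ _ _ _ (D i x Ux)).
apply: CkM => //; last exact: smooth_on_partial.
exact: (smooth_on_powR _ _ su).
Qed.

Lemma smoothP f : smooth f <-> smooth_on setT f.
Proof.
split=> [sf k|sf].
  have H k' s : Ck k' setT (iter_partial s f).
    elim: k' s => [|k' IH] s /=; first by move=> x _; have [+ _] := sf s; exact.
    split => [x _|i x _|i]; first by have [+ _] := sf s; exact.
      by have [_] := sf s; exact.
    exact: (IH (i :: s)).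
  exact: (H k [::]).
move=> s; have : smooth_on setT (iter_partial s f).
  by elim: s => [//|i s IH] /=; exact: smooth_on_partial.
move=> ss; split => [x|i x]; first exact: (smooth_on_continuous ss).
exact: (smooth_on_derivable i ss).
Qed.

End smooth_calculus.
Arguments smooth_on_derivable {R n U f} i {x} _ _.

(** * The Euler field and the spherical Laplacian *)

(* Keeps conversion from unfolding limits and the fixpoint behind smooth_on. *)
Local Opaque partial smooth_on.

Section euler_spherical.
Context (R : realType) (n : nat).
Implicit Types (f g u v : 'rV[R]_n -> R) (x y : 'rV[R]_n) (U V : set 'rV[R]_n).

Definition sqnorm x : R := \sum_i x ord0 i ^+ 2.

Definition euler f x : R := \sum_i x ord0 i * partial i f x.

(** The component of the gradient orthogonal to x, multiplied by |x|^2. The factor avoids a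
    division, so the field is smooth at the origin too and polynomial when f is. *)
Definition tangential i f x : R := sqnorm x * partial i f x - x ord0 i * euler f x.

(* Minus the Laplace-Beltrami operator of the sphere, acting on each sphere
   centred at the origin and written as a divergence. *)
Definition sph_laplacian f x : R := - \sum_i partial i (tangential i f) x.

(** This is |x|^2 times the inner product of the spherical parts of the two gradients, written in
    the asymmetric form that integration by parts produces. *)
Definition tangential_dot u v x : R := \sum_i partial i u x * tangential i v x.

Lemma partial_sum (I : Type) (r : seq I) (F : I -> 'rV[R]_n -> R) i x :
  (forall j, derivable (F j) x (delta_mx ord0 i)) ->
  partial i (fun y => \sum_(j <- r) F j y) x = \sum_(j <- r) partial i (F j) x.
Proof.
move=> dF.
have H : is_derive x (delta_mx ord0 i) (fun y => \sum_(j <- r) F j y)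
   (\sum_(j <- r) partial i (F j) x).
  elim: r => [|a r IH].
    by rewrite big_nil; under eq_fun do rewrite big_nil; exact: is_derive_cst.
  rewrite big_cons; under eq_fun do rewrite big_cons.
  by apply: is_deriveD; exact: derivableP.
exact: (@derive_val _ _ _ _ _ _ _ H).
Qed.

Lemma smooth_on_sqnorm U : open U -> smooth_on U sqnorm.
Proof.
move=> oU; apply: smooth_on_sum => // i.
by under eq_fun do rewrite expr2; apply: smooth_onM => //; exact: smooth_on_coord.
Qed.

Lemma smooth_on_euler U f : open U -> smooth_on U f -> smooth_on U (euler f).
Proof.
move=> oU sf; apply: smooth_on_sum => // i; apply: smooth_onM => //.
  exact: smooth_on_coord.
exact: smooth_on_partial.
Qed.

Lemma smooth_on_tangential U i f : open U -> smooth_on U f ->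
  smooth_on U (tangential i f).
Proof.
move=> oU sf; apply: smooth_onB => //; apply: smooth_onM => //.
- exact: smooth_on_sqnorm.
- exact: smooth_on_partial.
- exact: smooth_on_coord.
- exact: smooth_on_euler.
Qed.

Lemma smooth_on_sph_laplacian U f : open U -> smooth_on U f ->
  smooth_on U (sph_laplacian f).
Proof.
move=> oU sf; apply: smooth_onN => //; apply: smooth_on_sum => // i.
by apply: smooth_on_partial; exact: smooth_on_tangential.
Qed.

Lemma derivable_coord i j x :
  derivable (fun y : 'rV[R]_n => y ord0 j) x (delta_mx ord0 i).
Proof. by apply: (smooth_on_derivable i (@smooth_on_coord R n setT j)). Qed.

Lemma partial_sqnorm i x : partial i sqnorm x = 2 * x ord0 i.
Proof.
rewrite /sqnorm partial_sum => [|j]; last first.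
  by under eq_fun do rewrite expr2; apply: derivableM; exact: derivable_coord.
rewrite (bigD1 i)//= big1 => [|j ji].
  under eq_fun do rewrite expr2.
  rewrite partialM ?partial_coord ?eqxx; [rewrite mulr1n; ring|exact: derivable_coord..].
under eq_fun do rewrite expr2.
rewrite partialM ?partial_coord 1?eq_sym ?(negbTE ji);
  [rewrite mulr0n; ring|exact: derivable_coord..].
Qed.

Lemma euler_near_eq U f g x : open U -> U x -> {in U, f =1 g} ->
  euler f x = euler g x.
Proof.
by move=> oU Ux fg; apply: eq_bigr => i _; rewrite (partial_near_eq _ oU Ux fg).
Qed.

Lemma tangential_near_eq U i f g x : open U -> U x -> {in U, f =1 g} ->
  tangential i f x = tangential i g x.
Proof.
move=> oU Ux fg.
by rewrite /tangential (partial_near_eq _ oU Ux fg) (euler_near_eq oU Ux fg).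
Qed.

Lemma sph_laplacian_near_eq U f g x : open U -> U x -> {in U, f =1 g} ->
  sph_laplacian f x = sph_laplacian g x.
Proof.
move=> oU Ux fg.
have H i : partial i (tangential i f) x = partial i (tangential i g) x.
  apply: (@partial_near_eq R n U i (tangential i f) (tangential i g) x oU Ux).
  by move=> y; rewrite inE => Uy; exact: (tangential_near_eq i oU Uy fg).
by rewrite /sph_laplacian; apply: (congr1 -%R); apply: eq_bigr => i _; exact: H.
Qed.

Lemma smooth_partialD U i f g x : smooth_on U f -> smooth_on U g -> U x ->
  partial i (fun y => f y + g y) x = partial i f x + partial i g x.
Proof.
by move=> sf sg Ux; apply: partialD; 
  [exact: (smooth_on_derivable i sf Ux)|exact: (smooth_on_derivable i sg Ux)].
Qed.

Lemma smooth_partialM U i f g x : smooth_on U f -> smooth_on U g -> U x ->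
  partial i (fun y => f y * g y) x = partial i f x * g x + f x * partial i g x.
Proof.
by move=> sf sg Ux; apply: partialM; 
  [exact: (smooth_on_derivable i sf Ux)|exact: (smooth_on_derivable i sg Ux)].
Qed.

Lemma smooth_partialB U i f g x : open U -> smooth_on U f -> smooth_on U g -> U x ->
  partial i (fun y => f y - g y) x = partial i f x - partial i g x.
Proof.
move=> oU sf sg Ux; rewrite (_ : (fun y => _) = (fun y => f y + -1 * g y)); last first.
  by apply/funext => y; rewrite mulN1r.
rewrite (smooth_partialD _ sf) //; last first.
  by apply: smooth_onM => //; exact: smooth_on_cst.
by rewrite (smooth_partialM _ (smooth_on_cst U (-1)) sg Ux) partial_cst mul0r add0r mulN1r.
Qed.

Lemma eulerM U f g x : smooth_on U f -> smooth_on U g -> U x ->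
  euler (fun y => f y * g y) x = euler f x * g x + f x * euler g x.
Proof.
move=> sf sg Ux; rewrite /euler mulr_suml mulr_sumr -big_split/=.
by apply: eq_bigr => i _; rewrite (smooth_partialM i sf sg Ux); ring.
Qed.

Lemma eulerD U f g x : smooth_on U f -> smooth_on U g -> U x ->
  euler (fun y => f y + g y) x = euler f x + euler g x.
Proof.
move=> sf sg Ux; rewrite /euler -big_split/=.
by apply: eq_bigr => i _; rewrite (smooth_partialD i sf sg Ux); ring.
Qed.

Lemma eulerZ U c f x : smooth_on U f -> U x ->
  euler (fun y => c * f y) x = c * euler f x.
Proof.
move=> sf Ux; rewrite (eulerM (smooth_on_cst U c) sf Ux).
by rewrite {1}/euler big1 ?mul0r ?add0r// => i _; rewrite partial_cst mulr0.
Qed.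

Lemma tangentialD U i f g x : smooth_on U f -> smooth_on U g -> U x ->
  tangential i (fun y => f y + g y) x = tangential i f x + tangential i g x.
Proof.
move=> sf sg Ux; rewrite /tangential (smooth_partialD i sf sg Ux).
by rewrite (eulerD sf sg Ux); ring.
Qed.

Lemma sph_laplacianD U f g x : open U -> smooth_on U f -> smooth_on U g -> U x ->
  sph_laplacian (fun y => f y + g y) x = sph_laplacian f x + sph_laplacian g x.
Proof.
move=> oU sf sg Ux; rewrite /sph_laplacian -opprD -big_split/=; congr (- _).
apply: eq_bigr => i _.
rewrite (@partial_near_eq _ _ U _ _ (fun y => tangential i f y + tangential i g y)) //.
  by rewrite (@smooth_partialD U) //; exact: smooth_on_tangential.
by move=> y; rewrite inE => Uy; rewrite (tangentialD i sf sg Uy).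
Qed.

(** The tangential field is orthogonal to x, and the gradient of a radial factor is parallel to x.
    This is why radial weights pass through [sph_laplacian] and drop out of the integrations by
    parts on spheres. *)
Lemma sum_coord_tangential f x : \sum_i x ord0 i * tangential i f x = 0.
Proof.
rewrite /tangential; under eq_bigr do rewrite mulrBr.
rewrite sumrB; apply/eqP; rewrite subr_eq0; apply/eqP.
rewrite [RHS](_ : _ = \sum_i (x ord0 i ^+ 2 * euler f x)); last first.
  by apply: eq_bigr => i _; ring.
rewrite -mulr_suml -/(sqnorm x) [in RHS]/euler mulr_sumr.
by apply: eq_bigr => i _; ring.
Qed.

Section radial_factor.
Variables (U : set 'rV[R]_n) (rho rho' f : 'rV[R]_n -> R).
Hypotheses (oU : open U) (srho : smooth_on U rho) (sf : smooth_on U f).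
(** Expresses that rho is radial; [rho'] is its derivative in |x| divided by |x|. *)
Hypothesis drho : forall i x, U x -> partial i rho x = rho' x * x ord0 i.

Lemma euler_radial x : U x -> euler rho x = rho' x * sqnorm x.
Proof.
move=> Ux; rewrite /euler /sqnorm mulr_sumr; apply: eq_bigr => i _.
by rewrite drho//; ring.
Qed.

Lemma tangential_radialM i x : U x ->
  tangential i (fun y => rho y * f y) x = rho x * tangential i f x.
Proof.
move=> Ux; rewrite /tangential (smooth_partialM i srho sf Ux) (eulerM srho sf Ux).
by rewrite euler_radial// drho//; ring.
Qed.

Lemma sph_laplacian_radialM x : U x ->
  sph_laplacian (fun y => rho y * f y) x = rho x * sph_laplacian f x.
Proof.
move=> Ux; rewrite /sph_laplacian mulrN; congr (- _).
transitivity (\sum_i (rho' x * (x ord0 i * tangential i f x) +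
                      rho x * partial i (tangential i f) x)).
  apply: eq_bigr => i _.
  rewrite (@partial_near_eq _ _ U _ _ (fun y => rho y * tangential i f y)) //.
    by rewrite (@smooth_partialM U) ?drho ?mulrA//; exact: smooth_on_tangential.
  by move=> y; rewrite inE => Uy; rewrite tangential_radialM.
by rewrite big_split/= -!mulr_sumr sum_coord_tangential mulr0 add0r.
Qed.

End radial_factor.

Lemma sph_laplacianZ U c f x : open U -> smooth_on U f -> U x ->
  sph_laplacian (fun y => c * f y) x = c * sph_laplacian f x.
Proof.
move=> oU sf Ux.
apply: (@sph_laplacian_radialM U (fun=> c) (fun=> 0)) => //.
- exact: smooth_on_cst.
- by move=> i y _; rewrite partial_cst mul0r.
Qed.

(** The polar form of the Laplacian. Expanding the divergence in [sph_laplacian] gives 2 E f + |x|^2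
    laplacian f - n E f - E E f, a pointwise identity that needs no coordinates on the sphere. *)
Lemma laplacian_polar U f x : open U -> smooth_on U f -> U x ->
  sqnorm x * laplacian f x =
  euler (euler f) x + (n%:R - 2) * euler f x - sph_laplacian f x.
Proof.
move=> oU sf Ux; rewrite /sph_laplacian opprK.
have -> : \sum_i partial i (tangential i f) x =
  \sum_i (2 * (x ord0 i * partial i f x) + sqnorm x * partial i (partial i f) x -
          (euler f x + x ord0 i * partial i (euler f) x)).
  apply: eq_bigr => i _.
  rewrite (smooth_partialB _ oU) //; last 2 first.
  - by apply: smooth_onM => //; [exact: smooth_on_sqnorm|exact: smooth_on_partial].
  - by apply: smooth_onM => //; [exact: smooth_on_coord|exact: smooth_on_euler].
  rewrite (@smooth_partialM U) //; last 2 first.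
  - exact: smooth_on_sqnorm.
  - exact: smooth_on_partial.
  rewrite (@smooth_partialM U) //; last 2 first.
  - exact: smooth_on_coord.
  - exact: smooth_on_euler.
  rewrite partial_sqnorm partial_coord eqxx mulr1n; ring.
rewrite sumrB !big_split/= -!mulr_sumr -!/(euler _ _) sumr_const card_ord.
by rewrite -/(laplacian f x) -mulr_natl; ring.
Qed.

Lemma tangential_dotE u v x :
  tangential_dot u v x =
  sqnorm x * \sum_i partial i u x * partial i v x - euler u x * euler v x.
Proof.
rewrite /tangential_dot /tangential.
transitivity (\sum_i (sqnorm x * (partial i u x * partial i v x) -
   x ord0 i * partial i u x * euler v x)).
  by apply: eq_bigr => i _; ring.
by rewrite sumrB -mulr_sumr -mulr_suml.
Qed.

Lemma tangential_dotC u v x : tangential_dot u v x = tangential_dot v u x.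
Proof.
rewrite !tangential_dotE; congr (_ * _ - _); last by rewrite mulrC.
by apply: eq_bigr => i _; rewrite mulrC.
Qed.

(** Multiplied by |x|^2 the expression is the sum of the squares of the tangential components, by
    orthogonality to x. At x = 0, where this factor cannot be cancelled, both terms of
    [tangential_dotE] vanish. *)
Lemma tangential_dot_ge0 u x : 0 <= tangential_dot u u x.
Proof.
have s0 : 0 <= sqnorm x by apply: sumr_ge0 => i _; exact: sqr_ge0.
have H : sqnorm x * tangential_dot u u x = \sum_i tangential i u x ^+ 2.
  rewrite /tangential_dot mulr_sumr.
  transitivity (\sum_i (tangential i u x ^+ 2 +
    euler u x * (x ord0 i * tangential i u x))).
    apply: eq_bigr => i _; set T := tangential i u x.
    have TE : T = sqnorm x * partial i u x - x ord0 i * euler u x by [].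
    have P : sqnorm x * partial i u x = T + x ord0 i * euler u x by rewrite TE subrK.
    by rewrite mulrA P; ring.
  by rewrite big_split/= -mulr_sumr sum_coord_tangential mulr0 addr0.
have [s00|sp] := eqVneq (sqnorm x) 0.
  have x0 i : x ord0 i = 0.
    move: s00 => /eqP; rewrite psumr_eq0 => [|j _]; last exact: sqr_ge0.
    by move=> /allP/(_ i); rewrite mem_index_enum sqrf_eq0 => /(_ isT)/eqP.
  by rewrite tangential_dotE s00 mul0r /euler big1 ?mul0r ?subr0// => i _; rewrite x0 mul0r.
rewrite -(@pmulr_rge0 _ (sqnorm x)) ?lt0r ?sp// H.
by apply: sumr_ge0 => i _; exact: sqr_ge0.
Qed.

(** The mean value theorem applied to the second difference of f, in direction i and then in
    direction j. *)
Lemma mvt_mixed i j f x h : smooth_on setT f -> 0 < h ->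
  exists2 st : R * R, (0 < st.1 < h) && (0 < st.2 < h) &
  (f (h *: delta_mx ord0 i + (h *: delta_mx ord0 j + x)) - f (h *: delta_mx ord0 i + x)
   - (f (h *: delta_mx ord0 j + x) - f x)) =
  h ^+ 2 * partial j (partial i f) (st.2 *: delta_mx ord0 j + (st.1 *: delta_mx ord0 i + x)).
Proof.
move=> sf h0.
pose e i : 'rV[R]_n := delta_mx ord0 i.
have line k g y t : smooth_on setT g ->
    is_derive (t : R) 1 (fun s : R => g (s *: e k + y)) (partial k g (t *: e k + y)).
  move=> sg.
  have /partial_shift : is_derive (t *: e k + y) (e k) g (partial k g (t *: e k + y)).
    by apply: derivableP; exact: (smooth_on_derivable k sg).
  move=> H; apply: is_derive_translate.
  by under eq_fun do rewrite scalerDl -addrA.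
pose G s := f (s *: e i + (h *: e j + x)) - f (s *: e i + x).
have sp k g : smooth_on setT g -> smooth_on setT (partial k g) by exact: smooth_on_partial.
pose dGf s := partial i f (s *: e i + (h *: e j + x)) - partial i f (s *: e i + x).
have dG (s : R) : is_derive s 1 G (dGf s) by apply: is_deriveB; exact: line.
have cG : {within `[0, h], continuous G}.
  apply: derivable_within_continuous => s _.
  exact: (@ex_derive _ _ _ _ _ _ _ (dG s)).
have [s sh Gs] := @MVT R G dGf 0 h h0 (fun s _ => dG s) cG.
pose F (t : R) := partial i f (t *: e j + (s *: e i + x)).
pose dF (t : R) := partial j (partial i f) (t *: e j + (s *: e i + x)).
have dFE (t : R) : is_derive t 1 F (dF t) by apply: line; exact: sp.
have cF : {within `[0, h], continuous F}.
  apply: derivable_within_continuous => t _.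
  exact: (@ex_derive _ _ _ _ _ _ _ (dFE t)).
have [t th Ft] := @MVT R F dF 0 h h0 (fun t _ => dFE t) cF.
exists (s, t) => /=; first by move: sh th; rewrite !in_itv /= => -> ->.
move: Gs Ft; rewrite /G /F /dGf !scale0r !add0r !subr0 => ->.
have -> : s *: e i + (h *: e j + x) = h *: e j + (s *: e i + x) by rewrite addrCA.
move=> ->; rewrite /dF expr2; ring.
Qed.

Lemma dist_le_split (a b u v eps : R) :
  `|a - v| < eps / 2 -> `|b - u| < eps / 2 -> u = v -> `|a - b| <= eps.
Proof.
move=> av bu uv; rewrite -(subrKA v a (- b)) -{2}uv [eps]splitr.
by rewrite (le_trans (ler_normD _ _))// lerD ?ltW// distrC.
Qed.

(** The second difference is symmetric in i and j, so the two mixed partials take equal values at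
    points arbitrarily close to x; continuity does the rest. *)
Lemma partialC i j f x : smooth_on setT f ->
  partial i (partial j f) x = partial j (partial i f) x.
Proof.
move=> sf; pose e i : 'rV[R]_n := delta_mx ord0 i.
have c k l : {for x, continuous (partial k (partial l f))}.
  by apply: (@smooth_on_continuous _ _ setT) => //; do 2 apply: smooth_on_partial.
apply/eqP; rewrite -subr_eq0 -normr_le0; apply/ler_addgt0Pr => eps eps0; rewrite add0r.
have e2 : 0 < eps / 2 by rewrite divr_gt0.
have /cvgrPdist_lt/(_ _ e2)/nbhs_ballP[d1 /= d10 H1] := c i j.
have /cvgrPdist_lt/(_ _ e2)/nbhs_ballP[d2 /= d20 H2] := c j i.
pose d := Num.min d1 d2.
have d0 : 0 < d by rewrite lt_min d10.
have H y : `|x - y| < d ->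
    `|partial i (partial j f) x - partial i (partial j f) y| < eps / 2 /\
    `|partial j (partial i f) x - partial j (partial i f) y| < eps / 2.
  rewrite lt_min => /andP[y1 y2].
  by split; [apply: H1|apply: H2]; rewrite mx_norm_ball.
(* The intermediate points lie within h (|e_i| + |e_j|) < d of x; the summand 1 makes the inequality
   strict. *)
pose M := `|e i| + `|e j| + 1.
have M0 : 0 < M by rewrite ltr_wpDl ?addr_ge0.
pose h := d / M.
have h0 : 0 < h by rewrite divr_gt0.
have near s t (k l : 'I_n) : 0 < s < h -> 0 < t < h ->
    `|e k| + `|e l| = `|e i| + `|e j| -> `|x - (t *: e l + (s *: e k + x))| < d.
  move=> /andP[s0 sh] /andP[t0 th] ekl.
  rewrite addrA opprD addrCA subrr addr0 normrN.
  apply: (le_lt_trans (ler_normD _ _)); rewrite !normrZ !gtr0_norm//.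
  apply: (@le_lt_trans _ _ (h * (`|e i| + `|e j|))).
    by rewrite -ekl mulrDr addrC lerD// ler_wpM2r// ltW.
  by rewrite /h mulrAC ltr_pdivrMr// ltr_pM2l// /M ltrDl.
have [[s t] /= /andP[sh th] E1] := mvt_mixed i j x sf h0.
have [[s' t'] /= /andP[sh' th'] E2] := mvt_mixed j i x sf h0.
have E : partial j (partial i f) (t *: e j + (s *: e i + x)) =
         partial i (partial j f) (t' *: e i + (s' *: e j + x)).
  apply: (@mulfI _ (h ^+ 2)); first by rewrite expf_neq0// gt_eqF.
  apply: (etrans (esym E1)); apply: etrans E2.
  have -> : h *: delta_mx ord0 j + (h *: delta_mx ord0 i + x) =
            h *: delta_mx ord0 i + (h *: delta_mx ord0 j + x) :> 'rV[R]_n.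
    exact: addrCA.
  set A := f _; set B := f _; set C := f _; set D := f _.
  ring.
have [_ H3] := H _ (near _ _ _ _ sh th erefl).
have [H4 _] := H _ (near _ _ _ _ sh' th' (addrC _ _)).
exact: dist_le_split H4 H3 E.
Qed.

Lemma euler_partial i f x : smooth_on setT f ->
  partial i (euler f) x = partial i f x + euler (partial i f) x.
Proof.
move=> sf; rewrite /euler partial_sum => [|j]; last first.
  apply: (@smooth_on_derivable _ _ setT) => //; apply: smooth_onM => //.
  - exact: openT.
  - exact: smooth_on_coord.
  - exact: smooth_on_partial.
transitivity (\sum_j ((i == j)%:R * partial j f x + x ord0 j * partial j (partial i f) x)).
  apply: eq_bigr => j _.
  rewrite (@smooth_partialM setT).
  rewrite partial_coord.
  by rewrite partialC.
  - exact: smooth_on_coord.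
  - exact: smooth_on_partial.
  - exact: I.
rewrite big_split/=; congr (_ + _).
rewrite (bigD1 i)//= eqxx mul1r big1 ?addr0// => j ji.
by rewrite eq_sym (negbTE ji) mul0r.
Qed.

(** [tangential i] raises the degree of homogeneity by one and [partial i] lowers it by one, so
    their commutators with the Euler field cancel in the divergence. *)
Lemma euler_sph_laplacian f x : smooth_on setT f ->
  euler (sph_laplacian f) x = sph_laplacian (euler f) x.
Proof.
move=> sf; have oT := @openT 'rV[R]_n.
have st i := smooth_on_tangential i oT sf.
have sE := smooth_on_euler oT sf.
have tE i y : tangential i (euler f) y = euler (tangential i f) y - tangential i f y.
  have -> : euler (tangential i f) y = euler (fun y => sqnorm y * partial i f y) y
     - euler (fun y => y ord0 i * euler f y) y.
    rewrite /euler -sumrB; apply: eq_bigr => j _.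
    rewrite -mulrBr; congr (_ * _); rewrite (smooth_partialB _ oT) //.
      by apply: smooth_onM => //; [exact: smooth_on_sqnorm|exact: smooth_on_partial].
    by apply: smooth_onM => //; exact: smooth_on_coord.
  rewrite (@eulerM setT) //; [|exact: smooth_on_sqnorm|exact: smooth_on_partial].
  rewrite (@eulerM setT) //; [|exact: smooth_on_coord].
  rewrite /tangential euler_partial//.
  have -> : euler sqnorm y = 2 * sqnorm y.
    rewrite /euler /sqnorm mulr_sumr; apply: eq_bigr => j _.
    by rewrite partial_sqnorm; ring.
  have -> : euler (fun z : 'rV[R]_n => z ord0 i) y = y ord0 i.
    rewrite /euler (bigD1 i)//= partial_coord eqxx mulr1 big1 ?addr0// => j ji.
    by rewrite partial_coord (negbTE ji) mulr0.
  ring.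
rewrite /sph_laplacian.
have -> : euler (fun y => - \sum_i partial i (tangential i f) y) x =
   - \sum_i euler (partial i (tangential i f)) x.
  rewrite (_ : (fun y => _) = (fun y => -1 * \sum_i partial i (tangential i f) y)).
    rewrite (@eulerZ setT) // ?mulN1r; last first.
      by apply: smooth_on_sum => // i; exact: smooth_on_partial.
    congr (- _); rewrite /euler exchange_big/=; apply: eq_bigr => j _.
    rewrite -mulr_sumr; congr (_ * _); rewrite partial_sum // => i.
    by apply: (@smooth_on_derivable _ _ setT) => //; exact: smooth_on_partial.
  by apply/funext => y; rewrite mulN1r.
apply: (congr1 -%R); apply: eq_bigr => i _.
have -> : tangential i (euler f) = (fun y => euler (tangential i f) y - tangential i f y).
  by apply/funext => y; exact: tE.
rewrite (smooth_partialB _ oT (smooth_on_euler oT (st i)) (st i)); last exact: I.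
by rewrite (euler_partial _ _ (st i)) addrAC subrr add0r.
Qed.

End euler_spherical.

(** * Integration by parts on R^n *)

Section integration.
Context (R : realType).

Lemma rV_norm_lt n (x : 'rV[R]_n) (d : R) :
  0 < d -> (forall i, `|x ord0 i| < d) -> `|x| < d.
Proof.
move=> d0 H.
have : ball (0 : 'rV[R]_n) d x.
  by split => // i j; rewrite !ord1 mxE /ball/= sub0r normrN.
by rewrite mx_norm_ball /ball_ /= sub0r normrN.
Qed.

Lemma rV_coord_le n (x : 'rV[R]_n) i : `|x ord0 i| <= `|x|.
Proof.
have /mapP[j Hj ->] : `|x ord0 i| \in [seq `|x y.1 y.2| | y : 'I_1 * 'I_n].
  by apply/mapP; exists (ord0, i) => //=; rewrite mem_enum.
by rewrite [leRHS]/Num.norm /= mx_normrE; apply/bigmax_geP; right => /=; exists j.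
Qed.

(** f is the pointwise limit of step functions: [y k (z k x)] is the corner of the cell of mesh 1 /
    (k + 1) containing x. There are countably many cells, each a box and thus measurable for the
    product sigma-algebra. *)
Lemma continuous_measurable_rV n (f : 'rV[R]_n -> R) :
  continuous f -> measurable_fun setT f.
Proof.
move=> cf.
pose c (k : nat) : R := k.+1%:R.
have c0 k : 0 < c k by rewrite ltr0n.
pose z (k : nat) (x : 'rV[R]_n) : 'rV[int]_n := \row_i Num.floor (c k * x ord0 i).
pose y k (v : 'rV[int]_n) : 'rV[R]_n := \row_i ((v ord0 i)%:~R / c k).
apply: (@measurable_fun_cvg _ _ _ _ (fun k => f \o y k \o z k)).
  move=> k _ Y mY; rewrite setTI.
  rewrite (_ : _ @^-1` Y = \bigcup_(v in [set: 'rV[int]_n])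
     ([set x | z k x = v] `&` [set x | Y (f (y k v))])); last first.
    apply/seteqP; split=> x /=; first by move=> Yx; exists (z k x).
    by move=> [v _ [<-]].
  apply: countable_bigcupT_measurable => // v.
  apply: measurableI; last first.
    have [Yv|Yv] := pselect (Y (f (y k v))).
      rewrite (_ : [set _ | _] = setT) //.
      by apply/seteqP; split.
    rewrite (_ : [set _ | _] = set0) //.
    by apply/seteqP; split.
  rewrite (_ : [set x | _] = \bigcap_(i in [set: 'I_n])
    ((fun x : 'rV[R]_n => x ord0 i) @^-1` 
      `[(v ord0 i)%:~R / c k, (v ord0 i + 1)%:~R / c k[)); last first.
    apply/seteqP; split => x /=.
      move=> <- i _; rewrite /= in_itv/= mxE ler_pdivrMr// ltr_pdivlMr// mulrC.
      exact: floor_itv.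
    move=> H; apply/rowP => i; rewrite mxE; apply/eqP; rewrite floor_eq.
    have := H i I; rewrite /= in_itv/= ler_pdivrMr// ltr_pdivlMr// mulrC.
    by [].
  apply: fin_bigcap_measurable => // i _.
  by rewrite -[X in measurable X]setTI; apply: measurable_coord.
move=> x _.
apply: (@cvg_comp _ _ _ (fun k => y k (z k x)) f _ (nbhs x)); last exact: cf.
apply/cvgrPdist_lt => e e0; near=> k.
have ce : (c k)^-1 < e.
  near: k; exact: near_infty_natSinv_lt (PosNum e0).
apply: rV_norm_lt => // i; rewrite !mxE; apply: le_lt_trans ce.
have /andP[f1 f2] := floor_itv (c k * x ord0 i).
have -> : x ord0 i - (Num.floor (c k * x ord0 i))%:~R / c k =
    (c k * x ord0 i - (Num.floor (c k * x ord0 i))%:~R) / c k.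
  by rewrite mulrBl mulrAC divff ?gt_eqF// mul1r.
rewrite ger0_norm ?divr_ge0 ?subr_ge0 ?(ltW (c0 k))//.
rewrite ler_piMl ?invr_ge0 ?(ltW (c0 k))// lerBlDl ltW//.
by rewrite intrD in f2.
Unshelve. all: by end_near. Qed.

(** Bounded support, in the coordinatewise form that is inherited when one coordinate is frozen, as
    the induction on the dimension requires. *)
Definition vanish_out n (M : R) (f : 'rV[R]_n -> R) :=
  forall (x : 'rV[R]_n) i, M < `|x ord0 i| -> f x = 0.

Definition cube n (M : R) : set 'rV[R]_n :=
  [set x : 'rV[R]_n | forall i, x ord0 i \in `[- M, M]].

Lemma cube_vanish n M (f : 'rV[R]_n -> R) x :
  vanish_out M f -> ~ cube M x -> f x = 0.
Proof.
move=> vf /existsNP[i /negP]; rewrite in_itv/= -ler_norml -ltNge.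
exact: vf.
Qed.

Lemma measurable_cube n M : measurable (@cube n M).
Proof.
rewrite (_ : cube M = \bigcap_(i in [set: 'I_n])
     ((fun x : 'rV[R]_n => x ord0 i) @^-1` `[- M, M])); last first.
  by apply/seteqP; split => x /= Bx i; [move=> _|]; exact: Bx.
apply: fin_bigcap_measurable => // i _.
by rewrite -[X in measurable X]setTI; apply: measurable_coord.
Qed.

Lemma compact_cube n M : compact (@cube n M).
Proof.
apply: (@rV_compact _ _ (fun=> `[- M, M]%classic)).
by move=> _; apply: segment_compact.
Qed.

Lemma cube_fin n M : (lebesgue_rV R n (cube M) < +oo)%E.
Proof.
have [M0|M0] := leP 0 M.
  have H := @lebesgue_rV_box R n (\row_i - M) (\row_i M).
  rewrite (_ : cube M = [set x | forall i, x ord0 i \in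
    `[(\row_i0 - M : 'rV[R]_n) ord0 i, (\row_i0 M : 'rV[R]_n) ord0 i]]).
    by rewrite H ?ltry// => i; rewrite !mxE ge0_cp.
  by apply/seteqP; split => x Hx i; have := Hx i; rewrite !mxE.
(* For M < 0 the bounds of the box are in the wrong order for [lebesgue_rV_box], so the cube is
   enlarged to [cube 0]. *)
apply: (@le_lt_trans _ _ (lebesgue_rV R n (cube 0))).
  apply: le_measure; rewrite ?inE; do ?exact: measurable_cube.
  move=> x Hx i; have := Hx i; rewrite !in_itv/= oppr0 => /andP[h1 h2].
  by apply/andP; split; lra.
have H := @lebesgue_rV_box R n 0 0.
rewrite (_ : cube 0 = [set x | forall i, x ord0 i \in
    `[(0 : 'rV[R]_n) ord0 i, (0 : 'rV[R]_n) ord0 i]]).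
  by rewrite H ?ltry.
by apply/seteqP; split => x Hx i; have := Hx i; rewrite !mxE ?oppr0.
Qed.

Lemma vanish_out_bounded n M (f : 'rV[R]_n -> R) :
  continuous f -> vanish_out M f -> exists B, forall x, `|f x| <= B.
Proof.
move=> cf vf.
have /compact_bounded[B [_ HB]] : compact (f @` cube M).
  apply: continuous_compact; last exact: compact_cube.
  exact: continuous_subspaceT.
exists (`|B| + 1) => x.
have [Kx|/(cube_vanish vf) ->] := pselect (cube M x); last by rewrite normr0 addr_ge0.
apply: HB; last by exists x.
by rewrite (le_lt_trans (ler_norm _))// ltrDl.
Qed.

Lemma integrable_vanish d (T : measurableType d) (mu : {measure set T -> \bar R})
  (A : set T) (f : T -> R) (B : R) : measurable A -> (mu A < +oo)%E ->
  measurable_fun setT f -> (forall x, `|f x| <= B) -> (forall x, ~ A x -> f x = 0) ->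
  mu.-integrable setT (EFin \o f).
Proof.
move=> mA fA mf fB f0.
have -> : EFin \o f = (EFin \o f) \_ A.
  apply/funext => x; rewrite /patch; case: ifPn => //.
  by rewrite notin_setE => /f0 /= ->.
apply/(integrable_mkcond (D := A)) => //.
apply: measurable_bounded_integrable => //.
  exact: measurable_funTS.
exists B; split; first exact: num_real.
by move=> C BC x _ /=; rewrite (le_trans (fB x))// ltW.
Qed.

Lemma integrable_cc n M (f : 'rV[R]_n -> R) : continuous f -> vanish_out M f ->
  (lebesgue_rV R n).-integrable setT (EFin \o f).
Proof.
move=> cf vf; have [B HB] := vanish_out_bounded cf vf.
apply: (@integrable_vanish _ _ _ (cube M) f B) => //.
- exact: measurable_cube.
- exact: cube_fin.
- exact: continuous_measurable_rV.
- by move=> x; exact: cube_vanish.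
Qed.

Lemma integral_deriv0 (g h : R -> R) (M : R) :
  (forall t : R, is_derive t 1 g (h t)) -> continuous h ->
  (forall t, M < `|t| -> g t = 0) -> (forall t, M < `|t| -> h t = 0) ->
  (\int[@lebesgue_measure R]_t (h t)%:E = 0)%E.
Proof.
move=> dg ch g0 h0.
(* The functions are known to vanish only strictly beyond M, so the end points of the interval are
   taken further out. *)
pose N : R := `|M| + 1.
have MN : M < N by rewrite (le_lt_trans (ler_norm _))// ltrDl.
have N0 : 0 < N by rewrite ltr_wpDl.
have -> : (\int[@lebesgue_measure R]_t (h t)%:E =
           \int[@lebesgue_measure R]_(t in `[(- N)%R, N]) (h t)%:E)%E.
  rewrite [RHS]integral_mkcond; apply: eq_integral => t _.
  rewrite /patch; case: ifPn => //; rewrite notin_setE /= in_itv/= => /negP.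
  by rewrite -ler_norml -ltNge => /(lt_trans MN)/h0 ->.
have cg : continuous g.
  move=> t; apply: differentiable_continuous; apply/derivable1_diffP.
  exact: (@ex_derive _ _ _ _ _ _ _ (dg t)).
rewrite (@continuous_FTC2 _ h g).
- rewrite (g0 N) ?gtr0_norm// (g0 (- N)) ?normrN ?gtr0_norm//. by rewrite sube0.
- exact: gtrN.
- exact: continuous_subspaceT.
- split.
  + move=> t _; exact: (@ex_derive _ _ _ _ _ _ _ (dg t)).
  + by apply: cvg_at_right_filter; exact: cg.
  + by apply: cvg_at_left_filter; exact: cg.
- by move=> t _; rewrite derive1E (@derive_val _ _ _ _ _ _ _ (dg t)).
Qed.

Lemma continuous_consr n (a : R) : continuous (fun v : 'rV[R]_n => cons_rV (a, v)).
Proof.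
move=> v; apply/(@cvgrPdist_lt _ _ _ (nbhs v) (nbhs_filter v)) => e e0.
apply/nbhs_ballP; exists e => //= w.
rewrite mx_norm_ball /ball_ /= => vw; apply: rV_norm_lt => // i.
rewrite mxE [X in _ + X]mxE.
have [j ->|->] := unliftP ord0 i; last by rewrite !cons_rV0 /= subrr normr0.
rewrite !cons_rVS /=.
by have := rV_coord_le (v - w) j; rewrite !mxE => /le_lt_trans; apply.
Qed.

Lemma cons_line0 n (a t : R) (v : 'rV[R]_n) :
  cons_rV (t + a, v) = t *: delta_mx ord0 ord0 + cons_rV (a, v).
Proof.
apply/rowP => i; rewrite [RHS]mxE [X in _ = X + _]mxE [X in _ = _ * X + _]mxE eqxx /=.
have [j ->|->] := unliftP ord0 i; first by rewrite !cons_rVS /= mulr0 add0r.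
by rewrite !cons_rV0 /= mulr1.
Qed.

Lemma cons_lineS n j (a t : R) (v : 'rV[R]_n) :
  cons_rV (a, t *: delta_mx ord0 j + v) =
  t *: delta_mx ord0 (lift ord0 j) + cons_rV (a, v).
Proof.
apply/rowP => i; rewrite [RHS]mxE [X in _ = X + _]mxE [X in _ = _ * X + _]mxE eqxx /=.
have [k ->|->] := unliftP ord0 i.
  by rewrite !cons_rVS /= !mxE eqxx /= (inj_eq lift_inj).
by rewrite !cons_rV0 /= mulr0 add0r.
Qed.

Lemma continuous_consl n (v : 'rV[R]_n) : continuous (fun a : R => cons_rV (a, v)).
Proof.
move=> a.
have -> : (fun a : R => cons_rV (a, v)) =
   (fun a : R => a *: delta_mx ord0 ord0 + cons_rV (0 : R, v)).
  by apply/funext => b; rewrite -cons_line0 addr0.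
by apply: cvgD; [apply: cvgZr_tmp; exact: cvg_id|exact: cvg_cst].
Qed.

(** Fubini with the first coordinate split off. If i is a later coordinate, the inner integral over
    the remaining ones vanishes by induction; if i is the first, the inner integral is
    one-dimensional and vanishes by [integral_deriv0]. *)
Lemma integral_partial_eq0 n (g h : 'rV[R]_n -> R) i M :
  (forall x, is_derive x (delta_mx ord0 i) g (h x)) -> continuous h ->
  vanish_out M g -> vanish_out M h ->
  (\int[lebesgue_rV R n]_x (h x)%:E = 0)%E.
Proof.
elim: n g h i => [|n IH] g h i; first by case: i.
move=> dg ch vg vh.
have mh := continuous_measurable_rV ch.
have mc := @measurable_cons_rV R n.
have [B HB] := vanish_out_bounded ch vh.
have ih : (lebesgue_measure \x lebesgue_rV R n)%E.-integrable setT
    ((EFin \o h) \o @cons_rV R n).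
  apply: (@integrable_vanish _ _ _ (@cons_rV R n @^-1` cube M) (h \o @cons_rV R n) B) => //.
  - by rewrite -[X in measurable X]setTI; apply: mc => //; exact: measurable_cube.
  - exact: (@cube_fin n.+1 M).
  - exact: measurableT_comp.
  - by move=> x; exact: HB.
  - by move=> x /(cube_vanish vh).
rewrite [LHS](_ : _ = \int[(lebesgue_measure \x lebesgue_rV R n)%E]_p
  (EFin \o h) (cons_rV p))%E; last first.
  rewrite /lebesgue_rV -/lebesgue_rV /= /lebesgue_cons.
  rewrite (@integral_pushforward _ _ _ _ _ _ mc _ setT (EFin \o h)) ?preimage_setT//.
  exact/measurable_EFinP.
have [j ij|i0] := unliftP ord0 i.
  rewrite -(integral12_prod_meas1 ih) /fubini_F.
  rewrite integral0_eq// => a _.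
  apply: (IH (fun v => g (cons_rV (a, v))) (fun v => h (cons_rV (a, v))) j).
  - move=> v; apply/partial_shift; have /partial_shift := dg (cons_rV (a, v)).
    by rewrite ij; under [X in _ -> is_derive _ _ X _]eq_fun do rewrite cons_lineS.
  - by move=> v; apply: continuous_comp; [exact: continuous_consr|exact: ch].
  - by move=> v k Mk; apply: (vg _ (lift ord0 k)); rewrite cons_rVS.
  - by move=> v k Mk; apply: (vh _ (lift ord0 k)); rewrite cons_rVS.
rewrite -(integral21_prod_meas1 ih) /fubini_G.
rewrite integral0_eq// => v _ /=.
apply: (@integral_deriv0 (fun a => g (cons_rV (a, v))) (fun a => h (cons_rV (a, v))) M).
- move=> a; have /partial_shift := dg (cons_rV (a, v)); rewrite i0.
  under [X in is_derive _ _ X _ -> _]eq_fun do rewrite -cons_line0.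
  exact: is_derive_translate.
- by move=> a; apply: continuous_comp; [exact: continuous_consl|exact: ch].
- by move=> a Ma; apply: (vg _ ord0); rewrite cons_rV0.
- by move=> a Ma; apply: (vh _ ord0); rewrite cons_rV0.
Qed.

End integration.

(** * Spherical harmonic decomposition of polynomials *)

Section polynomials.
Context (R : realType) (n : nat).
Implicit Types (f g p : 'rV[R]_n -> R) (x z : 'rV[R]_n).

Let oT := @openT 'rV[R]_n.

Inductive homog : nat -> ('rV[R]_n -> R) -> Prop :=
| homog_cst c : homog 0 (fun=> c)
| homog_zero d : homog d (fun=> 0)
| homog_coord d f i : homog d f -> homog d.+1 (fun x => x ord0 i * f x)
| homog_add d f g : homog d f -> homog d g -> homog d (fun x => f x + g x).

Lemma homog_smooth d f : homog d f -> smooth_on setT f.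
Proof.
elim=> {d f} [c|d|d f i _ IH|d f g _ sf _ sg].
- exact: smooth_on_cst.
- exact: smooth_on_cst.
- by apply: smooth_onM => //; exact: smooth_on_coord.
- exact: smooth_onD.
Qed.

Lemma homog_scale c d f : homog d f -> homog d (fun x => c * f x).
Proof.
elim=> {d f} [a|d|d f i _ IH|d f g _ sf _ sg].
- exact: homog_cst.
- by under eq_fun do rewrite mulr0; exact: homog_zero.
- by under eq_fun do rewrite mulrCA; exact: homog_coord.
- by under eq_fun do rewrite mulrDr; exact: homog_add.
Qed.

Lemma homog_sum (I : Type) (r : seq I) d (F : I -> 'rV[R]_n -> R) :
  (forall i, homog d (F i)) -> homog d (fun x => \sum_(i <- r) F i x).
Proof.
move=> hF; elim: r => [|a r IH].
  by under eq_fun do rewrite big_nil; exact: homog_zero.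
by under eq_fun do rewrite big_cons; exact: homog_add.
Qed.

Lemma partial_coordM i j f : smooth_on setT f ->
  partial j (fun x => x ord0 i * f x) =
  (fun x => (j == i)%:R * f x + x ord0 i * partial j f x).
Proof.
move=> sf; apply/funext => x.
by rewrite (smooth_partialM j (smooth_on_coord setT i) sf I) partial_coord.
Qed.

Lemma homog_partial d f j : homog d f ->
  if d is d'.+1 then homog d' (partial j f) else partial j f = (fun=> 0).
Proof.
elim=> {d f} [a|d|d f i hf IH|d f g hf IHf hg IHg].
- by apply/funext => x; rewrite partial_cst.
- have -> : partial j (fun _ : 'rV[R]_n => 0 : R) = fun=> 0.
    by apply/funext => x; rewrite partial_cst.
  by case: d => // d; exact: homog_zero.
- rewrite partial_coordM; last exact: homog_smooth hf.
  case: d hf IH => [|d] hf IH.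
    rewrite IH; under eq_fun do rewrite mulr0 addr0.
    exact: homog_scale.
  apply: homog_add; first exact: homog_scale.
  exact: homog_coord.
- have -> : partial j (fun x => f x + g x) = (fun x => partial j f x + partial j g x).
    apply/funext => x.
    exact: (smooth_partialD j (homog_smooth hf) (homog_smooth hg)).
  case: d hf hg IHf IHg => [_ _ -> ->|d hf hg IHf IHg].
    by apply/funext => x; rewrite addr0.
  exact: homog_add.
Qed.

Lemma homog_euler d f : homog d f -> euler f = (fun x => d%:R * f x).
Proof.
elim=> {d f} [a|d|d f i hf IH|d f g hf IHf hg IHg]; apply/funext => x.
- by rewrite mul0r /euler big1// => i _; rewrite partial_cst mulr0.
- by rewrite mulr0 /euler big1// => i _; rewrite partial_cst mulr0.
- rewrite (eulerM (smooth_on_coord setT i) (homog_smooth hf) I) IH.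
  rewrite {1}/euler (bigD1 i)//= partial_coord eqxx mulr1 big1 ?addr0; last first.
    by move=> j ji; rewrite partial_coord (negbTE ji) mulr0.
  by rewrite -natr1; ring.
- by rewrite (eulerD (homog_smooth hf) (homog_smooth hg) I) IHf IHg mulrDr.
Qed.

Lemma homog_laplacian d f : homog d f ->
  if d is d'.+2 then homog d' (laplacian f) else laplacian f = (fun=> 0).
Proof.
case: d => [|[|d]] hf.
- apply/funext => x; rewrite /laplacian big1// => i _.
  by rewrite (homog_partial i hf) partial_cst.
- apply/funext => x; rewrite /laplacian big1// => i _.
  by rewrite (homog_partial i (homog_partial i hf)).
- apply: homog_sum => i.
  exact: (homog_partial i (homog_partial i hf)).
Qed.

Definition sph_eigenvalue (k : nat) : R := k%:R * (n%:R - 2 + k%:R).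

Lemma homog_sph_laplacian d f x : homog d f ->
  sph_laplacian f x = sph_eigenvalue d * f x - sqnorm x * laplacian f x.
Proof.
move=> hf; rewrite (laplacian_polar oT (homog_smooth hf) I).
rewrite (homog_euler hf) (eulerZ _ (homog_smooth hf) I) (homog_euler hf).
by rewrite /sph_eigenvalue; ring.
Qed.

(** No homogeneity is demanded: |x|^2 times an eigenfunction has to be one for the same k. *)
Definition sph_eigenfun (k : nat) f :=
  smooth_on setT f /\ forall x, sph_laplacian f x = sph_eigenvalue k * f x.

Lemma sph_eigenfun0 k : sph_eigenfun k (fun=> 0).
Proof.
split; first exact: smooth_on_cst.
move=> x; rewrite (homog_sph_laplacian x (homog_zero 0)) !mulr0 sub0r.
have -> : laplacian (fun _ : 'rV[R]_n => 0 : R) = fun=> 0.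
  exact: (homog_laplacian (homog_zero 0)).
by rewrite mulr0 oppr0.
Qed.

Lemma sph_eigenfunD k f g : sph_eigenfun k f -> sph_eigenfun k g ->
  sph_eigenfun k (fun x => f x + g x).
Proof.
move=> [sf ef] [sg eg]; split; first exact: smooth_onD.
by move=> x; rewrite (sph_laplacianD oT sf sg I) ef eg mulrDr.
Qed.

Lemma sph_eigenfunZ k c f : sph_eigenfun k f -> sph_eigenfun k (fun x => c * f x).
Proof.
move=> [sf ef]; split; first by apply: smooth_onM => //; exact: smooth_on_cst.
by move=> x; rewrite (sph_laplacianZ c oT sf I) ef mulrCA.
Qed.

Lemma sph_laplacian_sqnormM f x : smooth_on setT f ->
  sph_laplacian (fun x => sqnorm x * f x) x = sqnorm x * sph_laplacian f x.
Proof.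
move=> sf.
apply: (@sph_laplacian_radialM R n setT _ (fun=> 2) f oT _ sf _ x I).
  exact: smooth_on_sqnorm.
by move=> i y _; rewrite partial_sqnorm.
Qed.

Lemma sph_laplacian_sum (I : Type) (r : seq I) (F : I -> 'rV[R]_n -> R) x :
  (forall i, smooth_on setT (F i)) ->
  sph_laplacian (fun y => \sum_(i <- r) F i y) x = \sum_(i <- r) sph_laplacian (F i) x.
Proof.
move=> sF; elim: r => [|a r IH].
  under eq_fun do rewrite big_nil; rewrite big_nil.
  by have [_ ->] := sph_eigenfun0 0; rewrite mulr0.
under eq_fun do rewrite big_cons; rewrite big_cons -IH.
by rewrite (sph_laplacianD oT (sF a) (smooth_on_sum r oT sF) Logic.I).
Qed.

Lemma sph_eigenvalue_inj k d : (2 <= n)%N -> (k < d)%N ->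
  sph_eigenvalue d - sph_eigenvalue k != 0.
Proof.
move=> n2 kd; rewrite gt_eqF// /sph_eigenvalue.
have -> : d%:R * (n%:R - 2 + d%:R) - k%:R * (n%:R - 2 + k%:R) =
   (d%:R - k%:R) * (n%:R - 2 + d%:R + k%:R) :> R by ring.
have kd' : k%:R < d%:R :> R by rewrite ltr_nat.
have k0 : 0 <= k%:R :> R by rewrite ler0n.
have n2' : 2 <= n%:R :> R by rewrite (ler_nat _ 2).
by apply: mulr_gt0; lra.
Qed.

(* On homogeneous polynomials of degree d, sph_laplacian - sph_eigenvalue d is
   - |x|^2 laplacian, which lowers the degree of the harmonic components: solving
   away the decomposition of |x|^2 laplacian p leaves an eigenfunction. *)
Lemma homog_sph_decomposition d p : (2 <= n)%N -> homog d p ->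
  exists2 e : nat -> 'rV[R]_n -> R, forall k, sph_eigenfun k (e k) &
  forall x, p x = \sum_(k < d.+1) e k x.
Proof.
move=> n2; elim/ltn_ind: d p => d IH p hp.
have sp := homog_smooth hp.
have base : laplacian p = (fun=> 0) ->
  exists2 e : nat -> 'rV[R]_n -> R, forall k, sph_eigenfun k (e k) &
  forall x, p x = \sum_(k < d.+1) e k x.
  move=> lp; exists (fun k => if k == d then p else fun=> 0) => [k|x].
    case: eqP => [->|_]; last exact: sph_eigenfun0.
    split; first exact: sp.
    by move=> x; rewrite (homog_sph_laplacian x hp) lp mulr0 subr0.
  rewrite big_ord_recr/= eqxx big1 ?add0r// => i _.
  by rewrite ltn_eqF.
have := homog_laplacian hp.
case: d IH hp base => [|[|d]] IH hp base; [exact: base..|] => {base} hlp.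
have [//|e he pE] := IH d _ _ hlp.
pose c k := sph_eigenvalue d.+2 - sph_eigenvalue k.
(* Chosen so that [c k * u k] is |x|^2 [e k]: this is exactly what cancels the error term |x|^2
   laplacian p in the eigenvalue equation for p minus the sum of the [u k]. *)
pose u (k : 'I_d.+1) x := (c k)^-1 * (sqnorm x * e k x).
have ck (k : 'I_d.+1) : c k != 0.
  by apply: sph_eigenvalue_inj => //; exact: (ltn_trans (ltn_ord k)).
have se (k : 'I_d.+1) : smooth_on setT (fun x => sqnorm x * e k x).
  by apply: smooth_onM => //; [exact: smooth_on_sqnorm|have [] := he k].
have hu (k : 'I_d.+1) : sph_eigenfun k (u k).
  apply: sph_eigenfunZ; split; first exact: se.
  have [sek ek] := he k.
  by move=> x; rewrite (sph_laplacian_sqnormM x sek) ek mulrCA.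
have su k : smooth_on setT (u k) by have [] := hu k.
pose q x := p x - \sum_(k < d.+1) u k x.
have hq : sph_eigenfun d.+2 q.
  split; first by apply: smooth_onB => //; exact: smooth_on_sum.
  move=> x.
  have -> : q = (fun x => p x + -1 * \sum_(k < d.+1) u k x).
    by apply/funext => y; rewrite mulN1r.
  have sS := smooth_on_sum (index_enum 'I_d.+1) oT su.
  have sN : smooth_on setT (fun x => -1 * \sum_(k < d.+1) u k x).
    by apply: smooth_onM => //; exact: smooth_on_cst.
  rewrite (sph_laplacianD oT sp sN I) (sph_laplacianZ (-1) oT sS I).
  rewrite (sph_laplacian_sum _ _ su) (homog_sph_laplacian x hp) pE.
  have -> : \sum_(k < d.+1) sph_laplacian (u k) x =
     \sum_(k < d.+1) (sph_eigenvalue d.+2 * u k x - sqnorm x * e k x).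
    apply: eq_bigr => k _; have [_ ->] := hu k.
    have -> : sqnorm x * e k x = c k * u k x by rewrite /u mulVKf.
    by rewrite /c; ring.
  by rewrite sumrB -!mulr_sumr; ring.
(* Indices up to d carry the corrections, d + 2 carries the new eigenfunction, and d + 1 gets 0. *)
exists (fun k => if insub k is Some k' then u k' else if k == d.+2 then q else fun=> 0).
  move=> k; case: insubP => [k' _ <-|_]; first exact: hu.
  by case: eqP => [->|_]; [exact: hq|exact: sph_eigenfun0].
move=> x; rewrite big_ord_recr /= eqxx insubN; last by rewrite -leqNgt.
rewrite big_ord_recr /= insubN; last by rewrite ltnn.
rewrite ltn_eqF// addr0 /q addrC; apply/eqP; rewrite addrC -subr_eq0; apply/eqP.
rewrite (eq_bigr (fun k => u k x)) ?subrK ?subrr//.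
  by rewrite addrC subrK subrr.
by move=> i _; rewrite valK.
Qed.

Inductive polyfun : ('rV[R]_n -> R) -> Prop :=
| polyfun_homog d f : homog d f -> polyfun f
| polyfun_add f g : polyfun f -> polyfun g -> polyfun (fun x => f x + g x).

Lemma polyfun_scale c f : polyfun f -> polyfun (fun x => c * f x).
Proof.
elim=> {f} [d f hf|f g _ pf _ pg].
  by apply: (@polyfun_homog d); exact: homog_scale.
by under eq_fun do rewrite mulrDr; exact: polyfun_add.
Qed.

Lemma polyfun_coord i f : polyfun f -> polyfun (fun x => x ord0 i * f x).
Proof.
elim=> {f} [d f hf|f g _ pf _ pg].
  by apply: (@polyfun_homog d.+1); exact: homog_coord.
by under eq_fun do rewrite mulrDr; exact: polyfun_add.
Qed.

Lemma polyfun_sph_decomposition p : (2 <= n)%N -> polyfun p ->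
  exists N, exists2 e : nat -> 'rV[R]_n -> R, forall k, sph_eigenfun k (e k) &
  forall x, p x = \sum_(k < N) e k x.
Proof.
move=> n2; elim=> {p} [d f hf|f g _ [N1 [e1 he1 fE]] _ [N2 [e2 he2 gE]]].
  by exists d.+1; exact: homog_sph_decomposition.
exists (maxn N1 N2), (fun k x => (k < N1)%N%:R * e1 k x + (k < N2)%N%:R * e2 k x).
  by move=> k; apply: sph_eigenfunD; exact: sph_eigenfunZ.
have H N N' (e : nat -> 'rV[R]_n -> R) x : (N <= N')%N ->
    \sum_(k < N) e k x = \sum_(k < N') (k < N)%N%:R * e k x.
  move=> NN'; rewrite (big_ord_widen N' (fun k => e k x) NN') big_mkcond/=.
  by apply: eq_bigr => k _; case: ifP; rewrite ?mul1r ?mul0r.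
move=> x; rewrite fE gE (H N1 (maxn N1 N2)) ?leq_maxl//.
by rewrite (H N2 (maxn N1 N2)) ?leq_maxr// -big_split.
Qed.

End polynomials.

(* Bernstein's operator as the expectation of F at the end point of a random
   walk: the i-th coordinate of the position moves up by h with probability
   (x_i + L) / (2 L), so that polynomiality in x, positivity and the variance
   all follow by recursion on the steps. *)
Section bernstein.
Context (R : realType) (n : nat).
Implicit Types (F : 'rV[R]_n -> R) (x z : 'rV[R]_n) (l : seq 'I_n).
Variables (L h : R).

Let prob x (i : 'I_n) : R := (x ord0 i + L) / (2 * L).

Fixpoint walk F l z x : R :=
  if l is i :: l' then
    (1 - prob x i) * walk F l' z x + prob x i * walk F l' (z + h *: delta_mx ord0 i) x
  else F z.

Lemma walk_polyfun F l z : polyfun (walk F l z).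
Proof.
elim: l z => [|i l IH] z /=.
  by apply: (@polyfun_homog _ _ 0); exact: homog_cst.
have lin f a b : polyfun f -> polyfun (fun x => (a + b * x ord0 i) * f x).
  move=> pf.
  have -> : (fun x => (a + b * x ord0 i) * f x) = (fun x => a * f x + b * (x ord0 i * f x)).
    by apply/funext => x; ring.
  apply: polyfun_add; first exact: polyfun_scale.
  by apply: polyfun_scale; exact: polyfun_coord.
pose a : R := L / (2 * L); pose b : R := (2 * L)^-1.
have -> : (fun x => (1 - prob x i) * walk F l z x +
    prob x i * walk F l (z + h *: delta_mx ord0 i) x) =
  (fun x => (1 - a + - b * x ord0 i) * walk F l z x +
    (a + b * x ord0 i) * walk F l (z + h *: delta_mx ord0 i) x).
  by apply/funext => x; rewrite /prob /a /b; ring.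
by apply: polyfun_add; exact: lin.
Qed.

Lemma prob_itv x i : 0 < L -> cube L x -> 0 <= prob x i <= 1.
Proof.
move=> L0 /(_ i); rewrite in_itv /= => /andP[Lx xL].
rewrite /prob divr_ge0 /=; [|lra|lra].
by rewrite ler_pdivrMr; lra.
Qed.

(** On the cube the weights are probabilities, so each step takes an average and preserves the
    bound. *)
Lemma walk_dist F D l z x (eta K : R) : 0 < L -> cube L x ->
  (forall y, `|F y - F x| <= eta + K * D y) ->
  `|walk F l z x - F x| <= eta + K * walk D l z x.
Proof.
move=> L0 Lx FD; elim: l z => [|i l IH] z /=; first exact: FD.
have /andP[p0 p1] := prob_itv i L0 Lx.
set p := prob x i in p0 p1 *.
have := IH z; have := IH (z + h *: delta_mx ord0 i).
set a := walk F l _ x; set b := walk F l _ x.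
set da := walk D l _ x; set db := walk D l _ x.
rewrite !ler_norml => /andP[a1 a2] /andP[b1 b2].
apply/andP; split; nra.
Qed.

(** Squared bias plus variance in each coordinate: the steps in direction i are independent, with
    mean h p and variance h^2 p (1 - p). *)
Lemma walk_sqdist l z x :
  walk (fun y => \sum_i (y ord0 i - x ord0 i) ^+ 2) l z x =
  \sum_i ((z ord0 i + h * (count_mem i l)%:R * prob x i - x ord0 i) ^+ 2 +
          h ^+ 2 * (count_mem i l)%:R * (prob x i * (1 - prob x i))).
Proof.
elim: l z => [|j l IH] z /=.
  by apply: eq_bigr => i _; rewrite !mulr0 !mul0r !addr0.
rewrite !IH !mulr_sumr -big_split/=; apply: eq_bigr => i _.
rewrite !mxE eqxx /= [i == j]eq_sym.
have [->|ji] := eqVneq j i; last first.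
  rewrite add0n mulr0n mulr0 addr0.
  by move: (prob x j) (prob x i) (count_mem i l)%:R => p q c; ring.
rewrite mulr1n mulr1 natrD mulr1n.
by move: (prob x i) (count_mem i l)%:R => p c; ring.
Qed.

End bernstein.

(** * Weierstrass approximation on a cube *)

Section weierstrass.
Context (R : realType) (n : nat).
Implicit Types (F : 'rV[R]_n -> R) (x y z : 'rV[R]_n).

(** Close points are handled by uniform continuity. For distant ones the trivial bound 2 B is at
    most K times the squared distance. The quadratic form of the bound is what [walk_sqdist] can
    average. *)
Lemma cc_modulus F (M eta : R) : continuous F -> vanish_out M F -> 0 < eta ->
  exists2 K : R, 0 <= K & forall x y,
    `|F y - F x| <= eta + K * \sum_i (y ord0 i - x ord0 i) ^+ 2.
Proof.
move=> cF vF eta0.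
have [B HB] := vanish_out_bounded cF vF.
have B0 : 0 <= B by exact: le_trans (HB 0).
have [d d0 Hd] : exists2 d : R, 0 < d & forall x, cube (M + 1) x ->
    forall y, `|y - x| < d -> `|F y - F x| <= eta.
  have /compact_near_coveringP cov := @compact_cube R n (M + 1).
  have key : forall x, cube (M + 1) x -> \forall x' \near x & d \near (0 : R)^'+,
      forall y, `|y - x'| < d -> `|F y - F x'| <= eta.
    move=> x _.
    have e2 : 0 < eta / 2 by rewrite divr_gt0.
    have /cvgrPdist_lt/(_ _ e2)/nbhs_ballP[d1 /= d10 H1] := cF x.
    have d2 : 0 < d1 / 2 by rewrite divr_gt0.
    exists (ball x (d1 / 2), [set d | d < d1 / 2]).
      split => /=; first exact: nbhsx_ballx.
      exact: nbhs_right_lt.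
    move=> [x' d] /= []; rewrite mx_norm_ball /ball_ /= => xx' dd y yd.
    have P1 : `|F x - F x'| < eta / 2.
      by apply: H1; rewrite mx_norm_ball /ball_ /=; lra.
    have P2 : `|F x - F y| < eta / 2.
      apply: H1; rewrite mx_norm_ball /ball_ /=.
      have := ler_distD x' x y; rewrite [`|x' - y|]distrC; lra.
    have := ler_distD (F x) (F y) (F x'); rewrite [`|F y - F x|]distrC; lra.
  have H := cov R (0 : R)^'+
    (fun d x => forall y, `|y - x| < d -> `|F y - F x| <= eta)
    (at_right_proper_filter 0) key.
  have [d [d0 Hd]] : exists d, 0 < d /\ (cube (M + 1) `<=`
      (fun x => forall y, `|y - x| < d -> `|F y - F x| <= eta)).
    have H2 : \forall d \near (0 : R)^'+, 0 < d by exact: nbhs_right_gt.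
    have [d [h1 h2]] := filter_ex (filterI H2 H).
    by exists d.
  by exists d.
(* With d' <= 1, a point within d' of one outside the cube of half-side M + 1 lies outside that of
   half-side M, so F vanishes at both. *)
pose d' := Num.min d 1.
have d'0 : 0 < d' by rewrite lt_min d0 ltr01.
have H x y : `|y - x| < d' -> `|F y - F x| <= eta.
  rewrite lt_min => /andP[yd y1].
  have [Kx|Kx] := pselect (cube (M + 1) x); first exact: Hd.
  have [i Mi] : exists i, M + 1 < `|x ord0 i|.
    move/existsNP : Kx => [i /negP]; rewrite in_itv/= -ler_norml -ltNge => ?.
    by exists i.
  rewrite (vF x i); last by rewrite (lt_trans _ Mi)// ltrDl.
  rewrite (vF y i) ?subrr ?normr0 ?ltW//.
  have := rV_coord_le (y - x) i; rewrite !mxE => yx.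
  have := ler_distD (y ord0 i) (x ord0 i) 0; rewrite !subr0 [`|x ord0 i - _|]distrC.
  lra.
pose K := 2 * B / d' ^+ 2.
have K0 : 0 <= K by apply: divr_ge0; [apply: mulr_ge0; rewrite ?ler0n|exact: sqr_ge0].
exists K => // x y.
have S0 : 0 <= \sum_i (y ord0 i - x ord0 i) ^+ 2 by apply: sumr_ge0 => i _; exact: sqr_ge0.
have [/H yx|yx] := ltP `|y - x| d'; first by rewrite (le_trans yx)// lerDl mulr_ge0.
have [i di] : exists i, d' <= `|y ord0 i - x ord0 i|.
  apply: contrapT => /forallNP ni; move: yx; rewrite leNgt => /negP; apply.
  apply: rV_norm_lt => // i; rewrite !mxE ltNge; apply/negP; exact: ni.
have dS : d' ^+ 2 <= \sum_i (y ord0 i - x ord0 i) ^+ 2.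
  rewrite (bigD1 i)//= -[_ ^+ 2 in leRHS]real_normK ?num_real//.
  apply: ler_wpDr; first by apply: sumr_ge0 => j _; exact: sqr_ge0.
  by apply: lerXn2r => //; rewrite nnegrE ltW.
have FB : `|F y - F x| <= 2 * B.
  by rewrite (le_trans (ler_normB _ _))// mulr2n mulrDl mul1r lerD.
have BK : 2 * B = K * d' ^+ 2 by rewrite /K divfK// expf_neq0// gt_eqF.
apply: (le_trans FB); apply: ler_wpDl; first exact: ltW.
by rewrite BK; apply: ler_wpM2l.
Qed.

Lemma weierstrass F (M L eta : R) : continuous F -> vanish_out M F -> 0 < L -> 0 < eta ->
  exists2 p, polyfun p & forall x, cube L x -> `|p x - F x| <= eta.
Proof.
move=> cF vF L0 eta0.
have e2 : 0 < eta / 2 by rewrite divr_gt0.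
have [K K0 HK] := cc_modulus cF vF e2.
pose C := K * (n%:R * (4 * L ^+ 2)).
have C0 : 0 <= C.
  apply: mulr_ge0 => //; apply: mulr_ge0; first exact: ler0n.
  by apply: mulr_ge0; [exact: ler0n|exact: sqr_ge0].
pose N := (Num.truncn (C / (eta / 2))).+1.
have N0 : 0 < N%:R :> R by rewrite ltr0n.
have HN : C / N%:R <= eta / 2.
  rewrite ler_pdivrMr// mulrC -ler_pdivrMr// ltW//; exact: truncnS_gt.
pose l := flatten [seq nseq N i | i <- enum 'I_n].
have lN i : count_mem i l = N.
  rewrite /l count_flatten -map_comp sumnE big_map big_enum/= (bigD1 i)//=.
  rewrite count_nseq /= eqxx mul1n big1 ?addn0// => j ji.
  by rewrite count_nseq /= (negbTE ji) mul0n.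
(* N steps of this length in each coordinate, started at - L, end on average exactly at x. The bias
   vanishes, and the variance is at most 4 L^2 / N per coordinate, which gives the constant C. *)
pose h := 2 * L / N%:R.
exists (walk L h F l (const_mx (- L))); first exact: walk_polyfun.
move=> x Lx.
apply: le_trans (walk_dist h l (const_mx (- L)) L0 Lx (HK x)) _.
rewrite [eta in leRHS]splitr lerD2l; apply: le_trans HN.
rewrite walk_sqdist /C -!mulrA ler_wpM2l//.
apply: (@le_trans _ _ (\sum_(i < n) (4 * L ^+ 2 / N%:R))); last first.
  rewrite sumr_const card_ord -[leLHS]mulr_natl.
  by rewrite le_eqVlt; apply/orP; left; apply/eqP; ring.
apply: ler_sum => i _; rewrite lN mxE.
have /andP[p0 p1] := prob_itv i L0 Lx.
set p := _ / _ in p0 p1 *.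
have -> : - L + h * N%:R * p - x ord0 i = 0.
  by rewrite /h divfK ?gt_eqF// /p mulrC divfK ?gt_eqF ?mulr_gt0//; ring.
rewrite expr0n add0r.
have -> : h ^+ 2 * N%:R * (p * (1 - p)) = 4 * L ^+ 2 / N%:R * (p * (1 - p)).
  by rewrite /h; field; rewrite gt_eqF.
rewrite ler_piMr ?divr_ge0 ?mulr_ge0 ?sqr_ge0 ?ltW//.
nra.
Qed.

End weierstrass.

(** * The spectral gap of the spherical Laplacian *)

Section gap.
Context (R : realType) (n : nat).
Implicit Types (f g u v : 'rV[R]_n -> R) (x : 'rV[R]_n).

Let oT := @openT 'rV[R]_n.

Definition Int f : R := \int[lebesgue_rV R n]_x f x.

Definition cc (M : R) f := continuous f /\ vanish_out M f.

Lemma ccD M f g : cc M f -> cc M g -> cc M (fun x => f x + g x).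
Proof.
move=> [cf vf] [cg vg]; split; first by move=> x; exact: (cvgD (cf x) (cg x)).
by move=> x i Mx; rewrite (vf x i)// (vg x i)// addr0.
Qed.

Lemma ccM M f g : cc M f -> continuous g -> cc M (fun x => f x * g x).
Proof.
move=> [cf vf] cg; split; first by move=> x; exact: (cvgM (cf x) (cg x)).
by move=> x i Mx; rewrite (vf x i)// mul0r.
Qed.

Lemma ccZ M c f : cc M f -> cc M (fun x => c * f x).
Proof.
move=> cf; have -> : (fun x => c * f x) = (fun x => f x * c).
  by apply/funext => x; rewrite mulrC.
by apply: ccM => // x; exact: cst_continuous.
Qed.

Lemma cc0 M : cc M (fun=> 0).
Proof. by split => // x; exact: cst_continuous. Qed.

Lemma cc_sum M (I : Type) (r : seq I) (F : I -> 'rV[R]_n -> R) :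
  (forall i, cc M (F i)) -> cc M (fun x => \sum_(i <- r) F i x).
Proof.
move=> cF; elim: r => [|a r IH]; first by under eq_fun do rewrite big_nil; exact: cc0.
by under eq_fun do rewrite big_cons; exact: ccD.
Qed.

Lemma cc_integrable M f : cc M f -> (lebesgue_rV R n).-integrable setT (EFin \o f).
Proof. by move=> [cf vf]; exact: integrable_cc cf vf. Qed.

Lemma IntD M f g : cc M f -> cc M g -> Int (fun x => f x + g x) = Int f + Int g.
Proof. by move=> /cc_integrable cf /cc_integrable cg; exact: RintegralD. Qed.

Lemma IntZ M c f : cc M f -> Int (fun x => c * f x) = c * Int f.
Proof. by move=> /cc_integrable cf; exact: RintegralZl. Qed.

Lemma Int0 : Int (fun=> 0) = 0.
Proof. by rewrite /Int Rintegral_cst// mul0r. Qed.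

Lemma Int_ge0 f : (forall x, 0 <= f x) -> 0 <= Int f.
Proof. by move=> f0; apply: Rintegral_ge0. Qed.

Lemma Int_le M f g : cc M f -> cc M g -> (forall x, f x <= g x) -> Int f <= Int g.
Proof.
move=> /cc_integrable cf /cc_integrable cg fg.
by apply: le_Rintegral => // x _; exact: fg.
Qed.

Lemma Int_sum M (I : Type) (r : seq I) (F : I -> 'rV[R]_n -> R) :
  (forall i, cc M (F i)) ->
  Int (fun x => \sum_(i <- r) F i x) = \sum_(i <- r) Int (F i).
Proof.
move=> cF; elim: r => [|a r IH].
  by under eq_fun do rewrite big_nil; rewrite big_nil Int0.
under eq_fun do rewrite big_cons; rewrite big_cons -IH.
apply: (@IntD M); [exact: cF|exact: cc_sum].
Qed.

Lemma Int_partial M f g i : (forall x, is_derive x (delta_mx ord0 i) f (g x)) ->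
  vanish_out M f -> cc M g -> Int g = 0.
Proof.
move=> df vf [cg vg].
by rewrite /Int /Rintegral (integral_partial_eq0 df cg vf vg).
Qed.

Lemma smooth_on_continuousT f : smooth_on setT f -> continuous f.
Proof. by move=> sf x; exact: (smooth_on_continuous sf). Qed.

Lemma smooth_is_derive f i x : smooth_on setT f ->
  is_derive x (delta_mx ord0 i) f (partial i f x).
Proof. by move=> sf; apply: derivableP; exact: (smooth_on_derivable i sf). Qed.

(** The derivatives of u are supplied separately because u will contain the factor [bump], which is
    only once continuously differentiable. *)
Lemma Int_div_tangential M u (du : 'I_n -> 'rV[R]_n -> R) v :
  (forall i x, is_derive x (delta_mx ord0 i) u (du i x)) ->
  cc M u -> (forall i, cc M (du i)) -> smooth_on setT v ->
  Int (fun x => \sum_i du i x * tangential i v x) = Int (fun x => u x * sph_laplacian v x).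
Proof.
move=> dU cu cdu sv.
have st i := smooth_on_tangential i oT sv.
have ct i := smooth_on_continuousT (st i).
have cpt i := smooth_on_continuousT (smooth_on_partial i (st i)).
have cA : cc M (fun x => \sum_i du i x * tangential i v x).
  by apply: cc_sum => i; exact: ccM.
have cB : cc M (fun x => \sum_i u x * partial i (tangential i v) x).
  by apply: cc_sum => i; exact: ccM.
have H : Int (fun x => \sum_i du i x * tangential i v x +
              \sum_i u x * partial i (tangential i v) x) = 0.
  have -> : (fun x => \sum_i du i x * tangential i v x +
              \sum_i u x * partial i (tangential i v) x) =
     (fun x => \sum_i (du i x * tangential i v x + u x * partial i (tangential i v) x)).
    by apply/funext => x; rewrite big_split.
  rewrite (@Int_sum M) => [|i]; last by apply: ccD; exact: ccM.
  rewrite big1// => i _.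
  apply: (@Int_partial M (fun x => u x * tangential i v x) _ i).
  - move=> x.
    have -> : du i x * tangential i v x + u x * partial i (tangential i v) x =
        u x *: partial i (tangential i v) x + tangential i v x *: du i x.
      by rewrite /GRing.scale/= addrC; congr (_ + _); rewrite mulrC.
    exact: (is_deriveM (dU i x) (smooth_is_derive i x (st i))).
  - by have [] := ccM cu (ct i).
  - by apply: ccD; exact: ccM.
move: H; rewrite (IntD cA cB) => /eqP; rewrite addr_eq0 => /eqP ->.
rewrite -mulN1r -(IntZ _ cB); congr Int; apply/funext => x.
by rewrite /sph_laplacian mulN1r mulrN mulr_sumr.
Qed.

End gap.

Lemma open_sqnorm_lt (R : realType) n (c : R) : open [set x : 'rV[R]_n | sqnorm x < c].
Proof.
apply: (@open_comp _ _ (@sqnorm R n) [set y : R | y < c]); last exact: open_lt.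
move=> x _; apply: smooth_on_continuousT; apply: smooth_on_sqnorm; exact: openT.
Qed.

Lemma open_sqnorm_gt (R : realType) n (c : R) : open [set x : 'rV[R]_n | c < sqnorm x].
Proof.
apply: (@open_comp _ _ (@sqnorm R n) [set y : R | c < y]); last exact: open_gt.
move=> x _; apply: smooth_on_continuousT; apply: smooth_on_sqnorm; exact: openT.
Qed.

Lemma partial_val (R : realType) n i (f : 'rV[R]_n -> R) x d :
  is_derive x (delta_mx ord0 i) f d -> partial i f x = d.
Proof. by move=> H; exact: (@derive_val _ _ _ _ _ _ _ H). Qed.

Lemma tangential_dot_sum (R : realType) n (u v : 'rV[R]_n -> R) x :
  tangential_dot u v x = \sum_i partial i u x * tangential i v x.
Proof. by []. Qed.

Lemma euler0 (R : realType) n (x : 'rV[R]_n) : euler (fun=> 0 : R) x = 0.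
Proof. by rewrite /euler big1// => i _; rewrite partial_cst mulr0. Qed.

Lemma tangential0 (R : realType) n i (x : 'rV[R]_n) : tangential i (fun=> 0 : R) x = 0.
Proof. by rewrite /tangential partial_cst euler0 !mulr0 subrr. Qed.

Lemma sph_laplacian0 (R : realType) n (x : 'rV[R]_n) :
  sph_laplacian (fun=> 0 : R) x = 0.
Proof. by have [_ ->] := @sph_eigenfun0 R n 0; rewrite mulr0. Qed.

Local Opaque partial smooth_on tangential tangential_dot sph_laplacian.

(** * The spectral gap, tested against a compactly supported radial weight *)

Section bump.
Context (R : realType) (n : nat).
Implicit Types (f g u v e : 'rV[R]_n -> R) (x : 'rV[R]_n).
Variable b : R.
Hypothesis b0 : 0 < b.

Let oT := @openT 'rV[R]_n.

(** Squaring makes the positive part differentiable at 0 as well, where the difference quotient is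
    max(h, 0). *)
Lemma is_derive_sq_max (y : R) :
  is_derive y 1 (fun t : R => Num.max t 0 ^+ 2) (2 * Num.max y 0).
Proof.
have [y0|y0|->] := ltgtP y 0.
- have H : \near y, (fun=> 0) y = (fun t : R => Num.max t 0 ^+ 2) y.
    near=> z.
    have z0 : z < 0 by near: z; exact: lt_nbhsl.
    by rewrite max_r ?ltW// expr0n.
  rewrite mulr0.
  by apply: (near_eq_is_derive H); exact: is_derive_cst.
- have H : \near y, (fun t : R => t ^+ 2) y = (fun t : R => Num.max t 0 ^+ 2) y.
    near=> z.
    have z0 : 0 < z by near: z; exact: lt_nbhsr.
    by rewrite max_l ?ltW.
  apply: (near_eq_is_derive H).
  have -> : (fun t : R => t ^+ 2) = (fun t => t * t) by apply/funext => t; rewrite expr2.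
  have := @is_deriveM R R^o id id y 1 1 1 (is_derive_id _ _) (is_derive_id _ _).
  by move/is_derive_eq; apply; rewrite /GRing.scale/=; ring.
- rewrite mulr0.
  have H : h^-1 *: ((fun t : R => Num.max t 0 ^+ 2) (h *: 1 + 0) - Num.max 0 0 ^+ 2)
     @[h --> 0^'] --> (0 : R).
    apply: (@cvg_trans _ ((fun h : R => Num.max h 0) @ 0^')).
      apply: near_eq_cvg; near=> h.
      have h0 : h != 0 by near: h; exact: nbhs_dnbhs_neq.
      rewrite maxxx expr0n subr0 addr0 /GRing.scale/= mulr1.
      have [hp|hn] := leP h 0; first by rewrite expr0n mulr0.
      by rewrite expr2 mulKf.
    apply: cvg_within_filter.
    have : {for (0 : R), continuous (fun h : R => Num.max h 0)}.
      apply: (@continuous_max _ _ id (fun=> 0)); first exact: cvg_id.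
      exact: cst_continuous.
    by rewrite /prop_for /continuous_at maxxx.
  by split; [apply/cvg_ex; exists 0|apply: cvg_lim].
Unshelve. all: by end_near. Qed.

(* A compactly supported radial weight: it makes polynomials admissible in the
   integrations by parts against test functions. *)
Definition bump x : R := Num.max (b - sqnorm x) 0 ^+ 2.

Let gapfun x : R := b - sqnorm x.

Let sgap : smooth_on setT gapfun.
Proof. by apply: smooth_onB => //; [exact: smooth_on_cst|exact: smooth_on_sqnorm]. Qed.

Let partial_gap i x : partial i gapfun x = -2 * x ord0 i.
Proof.
rewrite (smooth_partialB i oT (smooth_on_cst _ b) (smooth_on_sqnorm oT) I).
by rewrite partial_cst partial_sqnorm sub0r mulNr.
Qed.

Let slope x : R := -4 * Num.max (b - sqnorm x) 0.

Lemma is_derive_bump i x :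
  is_derive x (delta_mx ord0 i) bump (slope x * x ord0 i).
Proof.
have H := is_derive_partial_comp (smooth_on_derivable i sgap I) (is_derive_sq_max (gapfun x)).
have -> : slope x * x ord0 i = 2 * Num.max (gapfun x) 0 * partial i gapfun x.
  by rewrite partial_gap /slope -/(gapfun x); ring.
exact: H.
Qed.

Lemma sqr_coord_le_sqnorm x i : x ord0 i ^+ 2 <= sqnorm x.
Proof.
rewrite /sqnorm (bigD1 i)//= lerDl; apply: sumr_ge0 => j _; exact: sqr_ge0.
Qed.

Lemma sqnorm_gt x i : b + 1 < `|x ord0 i| -> b < sqnorm x.
Proof.
move=> bx; apply: lt_le_trans (sqr_coord_le_sqnorm x i).
by rewrite -[_ ^+ 2]real_normK ?num_real// expr2; nra.
Qed.

Lemma continuous_max_gap : continuous (fun x => Num.max (b - sqnorm x) 0).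
Proof.
move=> x; apply: (@continuous_max _ _ gapfun (fun=> 0)).
  exact: smooth_on_continuousT.
exact: cst_continuous.
Qed.

Lemma cc_bump : cc (b + 1) bump.
Proof.
split; last first.
  move=> x i /sqnorm_gt bx; rewrite /bump max_r ?expr0n//.
  by rewrite subr_le0 ltW.
have c := continuous_max_gap.
have -> : bump = (fun x => Num.max (b - sqnorm x) 0 * Num.max (b - sqnorm x) 0).
  by apply/funext => x; rewrite /bump expr2.
by move=> x; exact: (cvgM (c x) (c x)).
Qed.

Lemma cc_slope : cc (b + 1) slope.
Proof.
apply: ccZ; split; first exact: continuous_max_gap.
by move=> x i /sqnorm_gt bx; rewrite max_r// subr_le0 ltW.
Qed.

Lemma bump_ge0 x : 0 <= bump x.
Proof. exact: sqr_ge0. Qed.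

Definition IK f : R := Int (fun x => bump x * f x).

Lemma cc_bumpM f : smooth_on setT f -> cc (b + 1) (fun x => bump x * f x).
Proof. by move=> sf; apply: ccM; [exact: cc_bump|exact: smooth_on_continuousT]. Qed.

Lemma IKD f g : smooth_on setT f -> smooth_on setT g ->
  IK (fun x => f x + g x) = IK f + IK g.
Proof.
move=> sf sg; rewrite /IK -(IntD (cc_bumpM sf) (cc_bumpM sg)).
by congr Int; apply/funext => x; rewrite mulrDr.
Qed.

Lemma IKZ c f : smooth_on setT f -> IK (fun x => c * f x) = c * IK f.
Proof.
move=> sf; rewrite /IK -(IntZ c (cc_bumpM sf)).
by congr Int; apply/funext => x; rewrite mulrCA.
Qed.

Lemma IK_ge0 f : (forall x, 0 <= f x) -> 0 <= IK f.
Proof. by move=> f0; apply: Int_ge0 => x; apply: mulr_ge0 => //; exact: bump_ge0. Qed.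

(** The gradient of the bump is parallel to x, hence orthogonal to the tangential field: the weight
    adds no term. *)
Lemma IK_tangential_dot u v : smooth_on setT u -> smooth_on setT v ->
  IK (fun x => u x * sph_laplacian v x) = IK (tangential_dot u v).
Proof.
move=> su sv.
pose du i x := bump x * partial i u x + u x * (slope x * x ord0 i).
have H : Int (fun x => \sum_i du i x * tangential i v x) =
    Int (fun x => bump x * u x * sph_laplacian v x).
  apply: (@Int_div_tangential _ _ (b + 1) (fun x => bump x * u x) du v) => //.
  - move=> i x.
    exact: (is_deriveM (is_derive_bump i x) (smooth_is_derive i x su)).
  - exact: cc_bumpM.
  - move=> i; apply: ccD; first by apply: cc_bumpM; exact: smooth_on_partial.
    have -> : (fun x => u x * (slope x * x ord0 i)) = (fun x => slope x * (u x * x ord0 i)).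
      by apply/funext => x; ring.
    apply: ccM; first exact: cc_slope.
    apply: smooth_on_continuousT; apply: smooth_onM => //; exact: smooth_on_coord.
transitivity (Int (fun x => bump x * u x * sph_laplacian v x)).
  by congr Int; apply/funext => x; rewrite mulrA.
rewrite -H; congr Int; apply/funext => x.
transitivity (\sum_i (bump x * (partial i u x * tangential i v x) +
   u x * slope x * (x ord0 i * tangential i v x))).
  by apply: eq_bigr => i _; rewrite /du; ring.
by rewrite big_split/= -!mulr_sumr sum_coord_tangential mulr0 addr0.
Qed.

Lemma IK_sph_laplacianC u v : smooth_on setT u -> smooth_on setT v ->
  IK (fun x => u x * sph_laplacian v x) = IK (fun x => v x * sph_laplacian u x).
Proof.
move=> su sv; apply: (etrans (IK_tangential_dot su sv)).
apply: (etrans _ (esym (IK_tangential_dot sv su))).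
have -> // : tangential_dot u v = tangential_dot v u.
by apply/funext => x; exact: tangential_dotC.
Qed.

Section spectral_gap.
Variable gamma : R.
Hypothesis n2 : (2 <= n)%N.
Hypothesis gapE : forall k,
  0 <= (sph_eigenvalue R n k + gamma) * (sph_eigenvalue R n k + gamma - 1).

Definition shifted f x : R := sph_laplacian f x + gamma * f x.

Lemma smooth_shifted f : smooth_on setT f -> smooth_on setT (shifted f).
Proof.
move=> sf; apply: smooth_onD => //; first exact: smooth_on_sph_laplacian.
by apply: smooth_onM => //; exact: smooth_on_cst.
Qed.

Lemma smooth_scale (c : R) f : smooth_on setT f -> smooth_on setT (fun x => c * f x).
Proof. by move=> sf; apply: smooth_onM => //; exact: smooth_on_cst. Qed.

Lemma smooth_mul f g : smooth_on setT f -> smooth_on setT g ->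
  smooth_on setT (fun x => f x * g x).
Proof. exact: smooth_onM. Qed.

Lemma smooth_add f g : smooth_on setT f -> smooth_on setT g ->
  smooth_on setT (fun x => f x + g x).
Proof. exact: smooth_onD. Qed.

Definition gap_form f : R :=
  IK (fun x => shifted f x * shifted f x + -1 * (f x * shifted f x)).

Lemma IK_eigenfun k e g : sph_eigenfun k e -> smooth_on setT g ->
  IK (fun x => e x * shifted g x) =
  (sph_eigenvalue R n k + gamma) * IK (fun x => g x * e x).
Proof.
move=> [se ee] sg.
have sC := smooth_on_sph_laplacian oT sg.
have -> : (fun x => e x * shifted g x) =
   (fun x => e x * sph_laplacian g x + gamma * (g x * e x)).
  by apply/funext => x; rewrite /shifted; ring.
rewrite IKD; [|exact: smooth_mul|by apply: smooth_scale; exact: smooth_mul].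
rewrite IKZ; last exact: smooth_mul.
rewrite (IK_sph_laplacianC se sg).
have -> : (fun x => g x * sph_laplacian e x) =
   (fun x => sph_eigenvalue R n k * (g x * e x)).
  by apply/funext => x; rewrite ee; ring.
rewrite IKZ; last exact: smooth_mul.
by rewrite mulrDl.
Qed.

Lemma IK_eigenfun_orth k l e f : k != l -> sph_eigenfun k e -> sph_eigenfun l f ->
  IK (fun x => e x * f x) = 0.
Proof.
move=> kl [se ee] [sf ef].
have H : (sph_eigenvalue R n k - sph_eigenvalue R n l) * IK (fun x => e x * f x) = 0.
  rewrite mulrBl -!IKZ; [|exact: smooth_mul..].
  apply/eqP; rewrite subr_eq0; apply/eqP.
  transitivity (IK (fun x => f x * sph_laplacian e x)).
    by congr IK; apply/funext => x; rewrite ee; ring.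
  rewrite (IK_sph_laplacianC sf se).
  by congr IK; apply/funext => x; rewrite ef; ring.
have nz : sph_eigenvalue R n k - sph_eigenvalue R n l != 0.
  move: kl; rewrite neq_ltn => /orP[kl|lk]; last exact: sph_eigenvalue_inj.
  by rewrite -opprB oppr_eq0; exact: sph_eigenvalue_inj.
by move/eqP: H; rewrite mulf_eq0 (negbTE nz) /= => /eqP.
Qed.

Lemma IK_proj e f : smooth_on setT e -> smooth_on setT f ->
  exists a, IK (fun x => (f x + - a * e x) * e x) = 0.
Proof.
move=> se sf.
have E a : IK (fun x => (f x + - a * e x) * e x) =
    IK (fun x => f x * e x) - a * IK (fun x => e x * e x).
  have -> : (fun x => (f x + - a * e x) * e x) =
     (fun x => f x * e x + - a * (e x * e x)) by apply/funext => x; ring.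
  rewrite IKD; [|exact: smooth_mul|by apply: smooth_scale; exact: smooth_mul].
  by rewrite IKZ ?mulNr//; exact: smooth_mul.
have [e0|e0] := eqVneq (IK (fun x => e x * e x)) 0; last first.
  exists (IK (fun x => f x * e x) / IK (fun x => e x * e x)).
  by rewrite E divfK// subrr.
(* Here e has weighted norm 0 and no division is possible. The squared norm of f + t e is then
   affine and nonnegative in t, which forces its slope to vanish. *)
exists 0; rewrite E mul0r subr0.
have Q t : 0 <= IK (fun x => f x * f x) + 2 * t * IK (fun x => f x * e x).
  have : 0 <= IK (fun x => (f x + t * e x) * (f x + t * e x)).
    by apply: IK_ge0 => x; rewrite -expr2 sqr_ge0.
  have -> : (fun x => (f x + t * e x) * (f x + t * e x)) =
    (fun x => (f x * f x + 2 * t * (f x * e x)) + t * t * (e x * e x)).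
    by apply/funext => x; ring.
  rewrite IKD; [|by apply: smooth_add;
      [exact: smooth_mul|apply: smooth_scale; exact: smooth_mul]
    |by apply: smooth_scale; exact: smooth_mul].
  rewrite IKD; [|exact: smooth_mul|by apply: smooth_scale; exact: smooth_mul].
  rewrite !IKZ; [|exact: smooth_mul..].
  by rewrite e0 mulr0 addr0.
move: Q; move: (IK (fun x => f x * f x)) (IK (fun x => f x * e x)) => A B Q.
apply/eqP; apply: contraT => B0.
(* At this t the affine function would equal -1. *)
have := Q (- (A + 1) / (2 * B)).
have -> : 2 * (- (A + 1) / (2 * B)) * B = - (A + 1) by field.
lra.
Qed.

(** All cross terms vanish: by symmetry [IK_eigenfun] turns the product of e with [shifted g] into a
    multiple of that of g with e, which is 0. *)
Lemma gap_form_proj k e f a : sph_eigenfun k e -> smooth_on setT f ->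
  IK (fun x => (f x + - a * e x) * e x) = 0 ->
  gap_form (fun x => f x + - a * e x) <= gap_form f.
Proof.
move=> he sf; have [se ee] := he.
set g := (fun x => f x + - a * e x) => ge0.
have sg : smooth_on setT g by apply: smooth_add => //; exact: smooth_scale.
have sA := smooth_shifted sg.
pose la := sph_eigenvalue R n k + gamma.
have Af x : shifted f x = shifted g x + a * la * e x.
  have -> : f = (fun x => g x + a * e x).
    by apply/funext => y; rewrite /g; ring.
  rewrite /shifted (sph_laplacianD oT sg (smooth_scale a se) I).
  by rewrite (sph_laplacianZ a oT se I) ee /la; ring.
have fE x : f x = g x + a * e x by rewrite /g; ring.
have -> : gap_form f = IK (fun x =>
   ((shifted g x * shifted g x + -1 * (g x * shifted g x)) +
   (a * (2 * la - 1) * (e x * shifted g x) +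
   (- a * la * (g x * e x) + a ^+ 2 * (la * (la - 1)) * (e x * e x))))).
  by congr IK; apply/funext => x; rewrite Af fE; ring.
have s1 := smooth_mul se sA; have s2 := smooth_mul sg se; have s3 := smooth_mul se se.
have s4 : smooth_on setT (fun x => shifted g x * shifted g x + -1 * (g x * shifted g x)).
  by apply: smooth_add; [exact: smooth_mul|apply: smooth_scale; exact: smooth_mul].
have t1 c := smooth_scale c s1; have t2 c := smooth_scale c s2.
have t3 c := smooth_scale c s3.
rewrite (IKD s4 (smooth_add (t1 _) (smooth_add (t2 _) (t3 _)))).
rewrite (IKD (t1 _) (smooth_add (t2 _) (t3 _))) (IKD (t2 _) (t3 _)).
rewrite (IKZ _ s1) (IKZ _ s2) (IKZ _ s3) (IK_eigenfun he sg) ge0 !mulr0 !add0r.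
rewrite lerDl; apply: mulr_ge0; last by apply: IK_ge0 => x; rewrite -expr2 sqr_ge0.
by apply: mulr_ge0; [exact: sqr_ge0|exact: gapE].
Qed.

(* Each eigenfunction that is projected off removes a nonnegative multiple of
   lambda (lambda - 1) from the form. *)
Lemma gap_form_reduction N (e : nat -> 'rV[R]_n -> R) f :
  (forall k, sph_eigenfun k (e k)) -> smooth_on setT f ->
  exists g, [/\ smooth_on setT g, gap_form g <= gap_form f &
    IK (fun x => g x * g x) <=
    IK (fun x => (f x + -1 * \sum_(k < N) e k x) * (f x + -1 * \sum_(k < N) e k x))].
Proof.
move=> he; elim: N f => [|N IH] f sf.
  exists f; split => //; rewrite le_eqVlt; apply/orP; left; apply/eqP.
  by congr IK; apply/funext => x; rewrite big_ord0 mulr0 addr0.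
have [se ee] := he N.
have [a a0] := IK_proj se sf.
pose g1 x := f x + - a * e N x.
have sg1 : smooth_on setT g1 by apply: smooth_add => //; exact: smooth_scale.
have [g [sg gf gr]] := IH g1 sg1.
exists g; split => //; first exact: le_trans gf (gap_form_proj (he N) sf a0).
apply: (le_trans gr).
pose S x := \sum_(k < N) e k x.
have sS : smooth_on setT S by apply: smooth_on_sum => // i; have [] := he i.
(* The residual for N + 1 terms is r + (a - 1) [e N] with r orthogonal to [e N], so dropping the
   second summand can only decrease the norm. *)
pose r x := g1 x + -1 * S x.
have sr : smooth_on setT r by apply: smooth_add => //; exact: smooth_scale.
have re : IK (fun x => r x * e N x) = 0.
  have -> : (fun x => r x * e N x) = (fun x => g1 x * e N x + -1 * (S x * e N x)).
    by apply/funext => x; rewrite /r; ring.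
  rewrite IKD; [|exact: smooth_mul|by apply: smooth_scale; exact: smooth_mul].
  rewrite IKZ; last exact: smooth_mul.
  rewrite a0 add0r; suff -> : IK (fun x => S x * e N x) = 0 by rewrite mulr0.
  rewrite /IK.
  have -> : (fun x => bump x * (S x * e N x)) =
      (fun x => \sum_(k < N) bump x * (e k x * e N x)).
    by apply/funext => x; rewrite /S mulr_suml mulr_sumr.
  rewrite (@Int_sum _ _ (b + 1)).
    by apply: big1 => k _; apply: (IK_eigenfun_orth _ (he k) (he N)); rewrite ltn_eqF.
  by move=> k; apply: cc_bumpM; apply: smooth_mul => //; have [] := he k.
have -> : (fun x => (f x + -1 * \sum_(k < N.+1) e k x) * (f x + -1 * \sum_(k < N.+1) e k x)) =
  (fun x => r x * r x + (2 * (a - 1) * (r x * e N x) + (a - 1) ^+ 2 * (e N x * e N x))).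
  by apply/funext => x; rewrite big_ord_recr /= -/(S x) /r /g1; ring.
have s1 := smooth_mul sr sr; have s2 := smooth_mul sr se; have s3 := smooth_mul se se.
rewrite IKD; [|exact: s1|by apply: smooth_add;
  [exact: (smooth_scale _ s2)|exact: (smooth_scale _ s3)]].
rewrite IKD; [|exact: (smooth_scale _ s2)|exact: (smooth_scale _ s3)].
rewrite (IKZ _ s2) (IKZ _ s3) re mulr0 add0r lerDl.
apply: mulr_ge0; first exact: sqr_ge0.
by apply: IK_ge0 => x; rewrite -expr2 sqr_ge0.
Qed.

(** Completing the square pointwise leaves only the weighted L^2 norm of g, which is all that
    polynomial approximation controls. *)
Lemma gap_form_lower g : smooth_on setT g ->
  - (4^-1 * IK (fun x => g x * g x)) <= gap_form g.
Proof.
move=> sg; have sA := smooth_shifted sg.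
rewrite -subr_ge0 opprK /gap_form -IKZ; last exact: smooth_mul.
rewrite -IKD; [|by apply: smooth_add;
      [exact: smooth_mul|apply: smooth_scale; exact: smooth_mul]
    |by apply: smooth_scale; exact: smooth_mul].
apply: IK_ge0 => x.
have -> : shifted g x * shifted g x + -1 * (g x * shifted g x) + 4^-1 * (g x * g x) =
   (shifted g x - g x / 2) ^+ 2 by field.
exact: sqr_ge0.
Qed.

(** A polynomial within eta of f on the support of the bump splits into eigenfunctions. Projecting
    them off leaves g with squared norm at most eta^2 V and a form no larger than that of f, so the
    latter is at least - eta^2 V / 4. *)
Lemma gap_form_ge0 f M : smooth_on setT f -> vanish_out M f -> 0 <= gap_form f.
Proof.
move=> sf vf.
have s1 := smooth_on_cst [set: 'rV[R]_n] (1 : R).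
pose V := IK (fun=> 1).
have V0 : 0 <= V by apply: IK_ge0 => x; exact: ler01.
have key eta : 0 < eta -> - (4^-1 * (eta * eta * V)) <= gap_form f.
  move=> eta0.
  have b1 : 0 < b + 1 by rewrite addr_gt0.
  have [p pp pf] := weierstrass (smooth_on_continuousT sf) vf b1 eta0.
  have [N [e he pE]] := polyfun_sph_decomposition n2 pp.
  have [g [sg gf gp]] := gap_form_reduction N he sf.
  apply: (le_trans _ gf); apply: (le_trans _ (gap_form_lower sg)).
  rewrite lerN2; apply: ler_wpM2l; first by rewrite invr_ge0 ler0n.
  apply: (le_trans gp).
  have se : smooth_on setT (fun x => \sum_(k < N) e k x).
    by apply: smooth_on_sum => // i; have [] := he i.
  have sd : smooth_on setT (fun x => f x + -1 * \sum_(k < N) e k x).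
    by apply: smooth_add => //; exact: smooth_scale.
  rewrite /V -IKZ//; apply: (Int_le (cc_bumpM (smooth_mul sd sd)) (cc_bumpM (smooth_scale _ s1))).
  move=> x; have [bx|xb] := leP b (sqnorm x).
    by rewrite /bump max_r ?subr_le0// expr0n !mul0r.
  apply: ler_wpM2l; first exact: bump_ge0.
  have Lx : cube (b + 1) x.
    move=> i; rewrite in_itv/= -ler_norml leNgt; apply/negP => /sqnorm_gt.
    by rewrite ltNge (ltW xb).
  have := pf x Lx; rewrite pE mulN1r mulr1 distrC => H.
  by rewrite -[leLHS]expr2 -real_normK ?num_real// expr2; apply: ler_pM.
apply/ler_addgt0Pr => eps eps0.
pose W := V + 1.
have W0 : 0 < W by rewrite ltr_wpDl.
(* Since eta <= 1, the error eta^2 V is at most eta W, hence at most eps; W = V + 1 keeps the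
   divisor positive. *)
pose eta := Num.min 1 (eps / W).
have eta0 : 0 < eta by rewrite lt_min ltr01 divr_gt0.
have := key eta eta0.
have e1 : eta <= 1 by rewrite ge_min lexx.
have e2 : eta * W <= eps by rewrite -ler_pdivlMr// ge_min lexx orbT.
have eV : eta * eta * V <= eta * W.
  rewrite -mulrA; apply: ler_wpM2l; first exact: ltW.
  rewrite /W; apply: (@le_trans _ _ (1 * V)); first exact: ler_wpM2r.
  by rewrite mul1r lerDl.
lra.
Qed.

(* Apply gap_form_ge0 to f divided by b - |x|^2, the square root of the bump; radial
   factors commute with sph_laplacian. *)
Lemma spectral_gap f c : c < b -> smooth_on setT f ->
  (forall x, c < sqnorm x -> f x = 0) ->
  0 <= Int (fun x => shifted f x ^+ 2 - f x * shifted f x).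
Proof.
move=> cb sf f0.
(* The power is the inverse only for |x|^2 < b. Beyond, f is already 0, since c < b; the two open
   sets cover R^n, which makes g smooth everywhere. *)
pose g x := f x * gapfun x `^ (-1).
have oU := @open_sqnorm_lt R n b; have oV := @open_sqnorm_gt R n c.
have sg : smooth_on setT g.
  apply: (@smooth_on_sub _ _ ([set x | sqnorm x < b] `|` [set x | c < sqnorm x])).
    move=> x _; have [xb|bx] := ltP (sqnorm x) b; first by left.
    by right; exact: lt_le_trans bx.
  apply: smooth_onU.
    apply: smooth_onM => //; first exact: (smooth_on_sub _ sf).
    apply: smooth_on_powR => //; first exact: (smooth_on_sub _ sgap).
    by move=> x /=; rewrite subr_gt0.
  apply: (@smooth_on_eq _ _ _ (fun=> 0)) => //; last exact: smooth_on_cst.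
  by move=> x; rewrite inE /= => cx; rewrite /g f0// mul0r.
have fE x : f x = gapfun x * g x.
  have [xb|bx] := ltP (sqnorm x) b; last first.
    by rewrite /g f0 ?mul0r ?mulr0//; exact: lt_le_trans bx.
  have gx : 0 < gapfun x by rewrite subr_gt0.
  by rewrite /g powR_inv1 ?ltW// mulrCA divff ?mulr1// gt_eqF.
have Cf x : sph_laplacian f x = gapfun x * sph_laplacian g x.
  have -> : f = (fun x => gapfun x * g x) by apply/funext.
  apply: (@sph_laplacian_radialM R n setT gapfun (fun=> -2) g oT sgap sg _ x I).
  by move=> i y _; exact: partial_gap.
have vg : vanish_out (b + 1) g.
  move=> x i /sqnorm_gt bx; rewrite /g f0 ?mul0r//; exact: lt_trans bx.
have := gap_form_ge0 sg vg.
have -> // : gap_form g = Int (fun x => shifted f x ^+ 2 - f x * shifted f x).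
congr Int; apply/funext => x.
have [xb|bx] := ltP (sqnorm x) b; last first.
  rewrite /bump max_r ?subr_le0// expr0n mul0r.
  have cx : c < sqnorm x by exact: lt_le_trans bx.
  have C0 : sph_laplacian f x = 0.
    have -> : sph_laplacian f x = sph_laplacian (fun y => 0 * f y) x.
      apply: (sph_laplacian_near_eq oV cx) => y; rewrite inE => /= cy.
      by rewrite mul0r f0.
    by rewrite (sph_laplacianZ 0 oT sf I) mul0r.
  by rewrite /shifted C0 f0// !mulr0 addr0 expr0n mul0r subr0.
rewrite /bump max_l ?subr_ge0 ?(ltW xb)// -/(gapfun x).
by rewrite /shifted Cf fE; ring.
Qed.

End spectral_gap.

End bump.

(** * The weighted inequality in logarithmic coordinates *)

Section weighted_forms.
Context (R : realType) (n : nat).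
Implicit Types (f g u v w rho : 'rV[R]_n -> R) (x : 'rV[R]_n).
Variables (a c : R).
Hypotheses (a1 : 1 < a) (c0 : 0 < c).

Let oT := @openT 'rV[R]_n.
Let Om : set 'rV[R]_n := [set x | 1 < sqnorm x].
Let oOm : open Om := @open_sqnorm_gt R n 1.
Let oA := @open_sqnorm_lt R n a.
Let oC := @open_sqnorm_gt R n c.

(** The bounds are on |x|^2. Since a > 1 there is a collar around |x| = 1 where f vanishes, so that
    multiplication by powers of log |x|, singular there, gives a smooth function on all of R^n. *)
Definition annular f :=
  [/\ smooth_on setT f, forall x, sqnorm x < a -> f x = 0 &
      forall x, c < sqnorm x -> f x = 0].

Lemma annular_smooth f : annular f -> smooth_on setT f. Proof. by case. Qed.

Lemma annularD f g : annular f -> annular g -> annular (fun x => f x + g x).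
Proof.
move=> [sf f1 f2] [sg g1 g2]; split; first exact: smooth_onD.
  by move=> x xa; rewrite f1// g1// addr0.
by move=> x xc; rewrite f2// g2// addr0.
Qed.

Lemma annularMl f g : smooth_on setT f -> annular g -> annular (fun x => f x * g x).
Proof.
move=> sf [sg g1 g2]; split; first exact: smooth_onM.
  by move=> x xa; rewrite g1// mulr0.
by move=> x xc; rewrite g2// mulr0.
Qed.

Lemma annularZ (k : R) g : annular g -> annular (fun x => k * g x).
Proof. by move=> kg; apply: annularMl => //; exact: smooth_on_cst. Qed.

Lemma annular0 : annular (fun=> 0).
Proof. by split => //; exact: smooth_on_cst. Qed.

Lemma annular_sum (I : Type) (r : seq I) (F : I -> 'rV[R]_n -> R) :
  (forall i, annular (F i)) -> annular (fun x => \sum_(i <- r) F i x).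
Proof.
move=> cF; elim: r => [|k r IH].
  by under eq_fun do rewrite big_nil; exact: annular0.
by under eq_fun do rewrite big_cons; exact: annularD.
Qed.

Lemma annular_partial i f : annular f -> annular (partial i f).
Proof.
move=> [sf f1 f2]; split; first exact: smooth_on_partial.
  move=> x xa; rewrite (@partial_near_eq _ _ [set x | sqnorm x < a] i f (fun=> 0) x oA xa).
    exact: partial_cst.
  by move=> y; rewrite inE; exact: f1.
move=> x xc; rewrite (@partial_near_eq _ _ [set x | c < sqnorm x] i f (fun=> 0) x oC xc).
  exact: partial_cst.
by move=> y; rewrite inE; exact: f2.
Qed.

Lemma annular_euler f : annular f -> annular (euler f).
Proof.
move=> kf; apply: annular_sum => i; apply: annularMl; first exact: smooth_on_coord.
exact: annular_partial.
Qed.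

Lemma annular_near0 f x : annular f -> ~ Om x ->
  exists2 U, open U /\ U x & {in U, f =1 (fun=> 0)}.
Proof.
move=> [sf f1 _] Omx; exists [set x | sqnorm x < a].
  split; first exact: oA.
  by move: Omx => /negP; rewrite -leNgt => /le_lt_trans; apply.
by move=> y; rewrite inE; exact: f1.
Qed.

Lemma annular_sph_laplacian f : annular f -> annular (sph_laplacian f).
Proof.
move=> [sf f1 f2]; split; first exact: smooth_on_sph_laplacian.
  move=> x xa; rewrite (@sph_laplacian_near_eq _ _ [set x | sqnorm x < a] f (fun=> 0) x oA xa).
    exact: sph_laplacian0.
  by move=> y; rewrite inE; exact: f1.
move=> x xc; rewrite (@sph_laplacian_near_eq _ _ [set x | c < sqnorm x] f (fun=> 0) x oC xc).
  exact: sph_laplacian0.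
by move=> y; rewrite inE; exact: f2.
Qed.

Lemma annular_cc f : annular f -> cc (c + 1) f.
Proof.
move=> [sf _ f2]; split; first exact: smooth_on_continuousT.
by move=> x i cx; apply: f2; exact: (sqnorm_gt (i := i)).
Qed.

Definition radial rho rho' :=
  smooth_on Om rho /\ forall i x, Om x -> partial i rho x = rho' x * x ord0 i.

Lemma annular_smoothM rho f : smooth_on Om rho -> annular f -> annular (fun x => rho x * f x).
Proof.
move=> sr [sf f1 f2]; split.
- apply: (@smooth_on_sub _ _ (Om `|` [set x | sqnorm x < a])).
    move=> x _; have [x1|x1] := ltP 1 (sqnorm x); first by left.
    by right; exact: le_lt_trans a1.
  apply: smooth_onU.
    by apply: smooth_onM => //; exact: (smooth_on_sub _ sf).
  apply: (@smooth_on_eq _ _ _ (fun=> 0)) => //; last exact: smooth_on_cst.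
  by move=> x; rewrite inE => xa; rewrite f1// mulr0.
- by move=> x xa; rewrite f1// mulr0.
- by move=> x xc; rewrite f2// mulr0.
Qed.

Lemma euler_smoothM rho rho' f x : radial rho rho' -> annular f ->
  euler (fun x => rho x * f x) x = rho' x * sqnorm x * f x + rho x * euler f x.
Proof.
move=> [sr dr] kf; have [Ox|nOx] := pselect (Om x).
  rewrite (eulerM sr (smooth_on_sub (@subsetT _ _) (annular_smooth kf)) Ox).
  by rewrite (euler_radial dr Ox).
have krf := annular_smoothM sr kf.
have [U [oU Ux] U0] := annular_near0 krf nOx.
have [V [oV Vx] V0] := annular_near0 kf nOx.
rewrite (euler_near_eq oU Ux U0) (euler_near_eq oV Vx V0) !euler0.
by rewrite V0 ?inE// !mulr0 addr0.
Qed.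

Lemma sph_laplacian_smoothM rho rho' f x : radial rho rho' -> annular f ->
  sph_laplacian (fun x => rho x * f x) x = rho x * sph_laplacian f x.
Proof.
move=> [sr dr] kf; have [Ox|nOx] := pselect (Om x).
  exact: (sph_laplacian_radialM oOm sr (smooth_on_sub (@subsetT _ _) (annular_smooth kf)) dr Ox).
have krf := annular_smoothM sr kf.
have [U [oU Ux] U0] := annular_near0 krf nOx.
have [V [oV Vx] V0] := annular_near0 kf nOx.
rewrite (sph_laplacian_near_eq oU Ux U0) (sph_laplacian_near_eq oV Vx V0).
by rewrite !sph_laplacian0 mulr0.
Qed.

Lemma tangential_smoothM rho rho' f i x : radial rho rho' -> annular f ->
  tangential i (fun x => rho x * f x) x = rho x * tangential i f x.
Proof.
move=> [sr dr] kf; have [Ox|nOx] := pselect (Om x).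
  exact: (tangential_radialM sr (smooth_on_sub (@subsetT _ _) (annular_smooth kf)) dr i Ox).
have krf := annular_smoothM sr kf.
have [U [oU Ux] U0] := annular_near0 krf nOx.
have [V [oV Vx] V0] := annular_near0 kf nOx.
by rewrite (tangential_near_eq i oU Ux U0) (tangential_near_eq i oV Vx V0) tangential0 mulr0.
Qed.

Lemma radialM rho rho' sigma sigma' : radial rho rho' -> radial sigma sigma' ->
  radial (fun x => rho x * sigma x) (fun x => rho' x * sigma x + rho x * sigma' x).
Proof.
move=> [sr dr] [ss ds]; split; first exact: smooth_onM.
by move=> i x Ox; rewrite (smooth_partialM i sr ss Ox) dr// ds//; ring.
Qed.

Let sqnorm_Om_gt0 x : Om x -> 0 < sqnorm x.
Proof. by rewrite /Om /= => /(lt_trans _); apply; exact: ltr01. Qed.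

Lemma radial_sqnorm_powR (p : R) :
  radial (fun x => sqnorm x `^ p) (fun x => 2 * p * sqnorm x `^ (p - 1)).
Proof.
have sq : smooth_on Om (@sqnorm R n) by exact: smooth_on_sqnorm.
split; first by apply: smooth_on_powR => // x; exact: sqnorm_Om_gt0.
move=> i x Ox.
have := partial_powR p (smooth_on_derivable i sq Ox) (sqnorm_Om_gt0 Ox).
by move=> /partial_val ->; rewrite partial_sqnorm; ring.
Qed.

Definition log_norm x : R := ln (sqnorm x) / 2.

Lemma log_norm_gt0 x : Om x -> 0 < log_norm x.
Proof. by move=> Ox; rewrite divr_gt0// ln_gt0. Qed.

Lemma radial_log_norm_powR (p : R) :
  radial (fun x => log_norm x `^ p) (fun x => p * log_norm x `^ (p - 1) / sqnorm x).
Proof.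
have sq : smooth_on Om (@sqnorm R n) by exact: smooth_on_sqnorm.
have sl : smooth_on Om (fun x => ln (sqnorm x)).
  by apply: smooth_on_ln => // x; exact: sqnorm_Om_gt0.
have st : smooth_on Om log_norm.
  by apply: smooth_onM => //; exact: smooth_on_cst.
split; first by apply: smooth_on_powR => // x; exact: log_norm_gt0.
move=> i x Ox; have s0 := sqnorm_Om_gt0 Ox.
have := partial_powR p (smooth_on_derivable i st Ox) (log_norm_gt0 Ox).
move=> /partial_val ->.
rewrite (smooth_partialM i sl (smooth_on_cst Om 2^-1) Ox) partial_cst mulr0 addr0.
have := partial_ln (smooth_on_derivable i sq Ox) s0.
move=> /partial_val ->.
by rewrite partial_sqnorm; field; rewrite gt_eqF.
Qed.

(* |x|^(-n) t^p with t = log |x|: the measure |x|^(-n) dx is dt times the surface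
   measure of the sphere, so the Euler field, d/dt, is antisymmetric for p = 0. *)
Definition weight (p : R) x : R := sqnorm x `^ (- (n%:R / 2)) * log_norm x `^ p.

Definition weight' (p : R) x : R :=
  2 * - (n%:R / 2) * sqnorm x `^ (- (n%:R / 2) - 1) * log_norm x `^ p +
  sqnorm x `^ (- (n%:R / 2)) * (p * log_norm x `^ (p - 1) / sqnorm x).

Lemma radial_weight p : radial (weight p) (weight' p).
Proof. by apply: radialM; [exact: radial_sqnorm_powR|exact: radial_log_norm_powR]. Qed.

Lemma weight'E p x : Om x ->
  weight' p x * sqnorm x = - n%:R * weight p x + p * weight (p - 1) x.
Proof.
move=> Ox; have s0 := sqnorm_Om_gt0 Ox.
have E : sqnorm x `^ (- (n%:R / 2) - 1) * sqnorm x = sqnorm x `^ (- (n%:R / 2)).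
  rewrite -[in X in _ * X](powRr1 (ltW s0)) -powRD ?subrK//.
  by apply/implyP => _; rewrite gt_eqF.
rewrite /weight' /weight -E; field.
by rewrite gt_eqF.
Qed.

Definition wform (p : R) f g : R := Int (fun x => weight p x * (f x * g x)).

Lemma annular_weightM p f g : annular f -> annular g ->
  annular (fun x => weight p x * (f x * g x)).
Proof.
move=> kf kg; apply: annular_smoothM; first by have [] := radial_weight p.
by apply: annularMl => //; exact: annular_smooth.
Qed.

Lemma wformC p f g : wform p f g = wform p g f.
Proof. by congr Int; apply/funext => x; rewrite [f x * _]mulrC. Qed.

Lemma wformDl p f g h : annular f -> annular g -> annular h ->
  wform p (fun x => f x + g x) h = wform p f h + wform p g h.
Proof.
move=> kf kg kh; rewrite /wform.
rewrite -(IntD (annular_cc (annular_weightM p kf kh)) (annular_cc (annular_weightM p kg kh))).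
by congr Int; apply/funext => x; ring.
Qed.

Lemma wformZl p (k : R) f h : annular f -> annular h ->
  wform p (fun x => k * f x) h = k * wform p f h.
Proof.
move=> kf kh; rewrite /wform -(IntZ k (annular_cc (annular_weightM p kf kh))).
by congr Int; apply/funext => x; ring.
Qed.

Lemma wformDr p f g h : annular f -> annular g -> annular h ->
  wform p h (fun x => f x + g x) = wform p h f + wform p h g.
Proof. by move=> kf kg kh; rewrite wformC wformDl// ![wform p h _]wformC. Qed.

Lemma wformZr p (k : R) f h : annular f -> annular h ->
  wform p h (fun x => k * f x) = k * wform p h f.
Proof. by move=> kf kh; rewrite wformC wformZl// [wform p h _]wformC. Qed.

(** The divergence of the field x times [F] has integral 0. The factor |x|^(-n) of the weight
    cancels div x = n, leaving only the derivative of t^p. *)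
Lemma wform_euler p f g : annular f -> annular g ->
  wform p (euler f) g + wform p f (euler g) + p * wform (p - 1) f g = 0.
Proof.
move=> kf kg; have kE := annular_euler.
pose h x := f x * g x.
have kh : annular h by apply: annularMl => //; exact: annular_smooth.
pose F x := weight p x * h x.
have kF : annular F by exact: annular_weightM.
have kxF i : annular (fun x => x ord0 i * F x).
  by apply: annularMl => //; exact: smooth_on_coord.
have H : Int (fun x => \sum_i partial i (fun y => y ord0 i * F y) x) = 0.
  rewrite (@Int_sum _ _ (c + 1)) => [|i]; last first.
    by apply: annular_cc; exact: annular_partial.
  apply: big1 => i _.
  apply: (@Int_partial _ _ (c + 1) (fun y => y ord0 i * F y) _ i).
  - by move=> x; apply: smooth_is_derive; exact: annular_smooth.
  - by have [] := annular_cc (kxF i).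
  - by apply: annular_cc; exact: annular_partial.
rewrite /wform.
have c1 := annular_cc (annular_weightM p (kE _ kf) kg).
have c2 := annular_cc (annular_weightM p kf (kE _ kg)).
have c3 := annular_cc (annular_weightM (p - 1) kf kg).
rewrite -(IntD c1 c2) -(IntZ p c3) -(IntD (ccD c1 c2) (ccZ p c3)) -H.
congr Int; apply/funext => x.
have -> : \sum_i partial i (fun y => y ord0 i * F y) x = n%:R * F x + euler F x.
  transitivity (\sum_(i < n) (F x + x ord0 i * partial i F x)).
    apply: eq_bigr => i _; rewrite (partial_coordM _ _ (annular_smooth kF)).
    by rewrite eqxx mul1r.
  by rewrite big_split/= sumr_const card_ord mulr_natl.
rewrite (euler_smoothM x (radial_weight p) kh).
rewrite (eulerM (annular_smooth kf) (annular_smooth kg) I).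
have [Ox|nOx] := pselect (Om x).
  by rewrite (weight'E p Ox) /F /h; ring.
have [U [oU Ux] U0] := annular_near0 kf nOx.
have fx0 : f x = 0 by rewrite U0 ?inE.
have Ef0 : euler f x = 0 by rewrite (euler_near_eq oU Ux U0) euler0.
by rewrite Ef0 /F /h fx0; ring.
Qed.

Lemma wform_tangential_dot p u v : annular u -> annular v ->
  wform p u (sph_laplacian v) = Int (fun x => weight p x * tangential_dot u v x).
Proof.
move=> ku kv; have sv := annular_smooth kv.
pose F x := weight p x * u x.
have kF : annular F by apply: annular_smoothM => //; have [] := radial_weight p.
have H := Int_div_tangential (fun i x => smooth_is_derive i x (annular_smooth kF))
  (annular_cc kF) (fun i => annular_cc (annular_partial i kF)) sv.
transitivity (Int (fun x => F x * sph_laplacian v x)).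
  by congr Int; apply/funext => x; rewrite /F mulrA.
apply: (etrans (esym H)); congr Int; apply/funext => x.
(* Swapping the arguments puts the weighted function under [tangential], from which the radial
   factor can be pulled out. *)
rewrite -tangential_dot_sum tangential_dotC [tangential_dot u v x]tangential_dotC.
rewrite !tangential_dot_sum mulr_sumr; apply: eq_bigr => i _.
by rewrite (tangential_smoothM i x (radial_weight p) ku) mulrCA.
Qed.

Lemma wform_sph_laplacianC p u v : annular u -> annular v ->
  wform p u (sph_laplacian v) = wform p v (sph_laplacian u).
Proof.
move=> ku kv; apply: (etrans (wform_tangential_dot p ku kv)).
apply: (etrans _ (esym (wform_tangential_dot p kv ku))).
by congr Int; apply/funext => x; rewrite tangential_dotC.
Qed.

Lemma weight_ge0 p x : 0 <= weight p x.
Proof. by apply: mulr_ge0; exact: powR_ge0. Qed.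

Lemma wform_sph_laplacian_ge0 p u : annular u -> 0 <= wform p u (sph_laplacian u).
Proof.
move=> ku; rewrite wform_tangential_dot//; apply: Int_ge0 => x.
by apply: mulr_ge0; [exact: weight_ge0|exact: tangential_dot_ge0].
Qed.

Lemma wform_ge0 p u : 0 <= wform p u u.
Proof.
by apply: Int_ge0 => x; apply: mulr_ge0; [exact: weight_ge0|rewrite -expr2 sqr_ge0].
Qed.

(** * Hardy's inequality and the expansion of the square *)

Section rellich.
Variables (gamma m beta : R) (w : 'rV[R]_n -> R).
Hypotheses (n2 : (2 <= n)%N) (m0 : 0 <= m) (beta0 : 0 <= beta).
Hypothesis gapE : forall k,
  0 <= (sph_eigenvalue R n k + gamma) * (sph_eigenvalue R n k + gamma - 1).
Hypothesis kw : annular w.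
(** A convenient sufficient condition for h(t) <= 1: the summand 1 gives t >= 1, and then t^2 >= 2 m
    beta t + beta (beta + 1). *)
Hypothesis log_large : forall x, a <= sqnorm x ->
  1 + 2 * m * beta + beta * (beta + 1) <= log_norm x.

Let A := @shifted R n gamma.

Lemma annular_shifted f : annular f -> annular (A f).
Proof. by move=> kf; apply: annularD; [exact: annular_sph_laplacian|exact: annularZ]. Qed.

Lemma wform_gap p f : annular f -> wform p f (A f) <= wform p (A f) (A f).
Proof.
move=> kf; have kA := annular_shifted kf.
(* The square root of the weight. Radial factors commute with A, so the unweighted gap for [rho * f]
   is the weighted gap for f. *)
pose rho x := sqnorm x `^ (- (n%:R / 4)) * log_norm x `^ (p / 2).
have [rho' rr] : exists rho', radial rho rho'.
  by eexists; apply: radialM; [exact: radial_sqnorm_powR|exact: radial_log_norm_powR].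
have kg : annular (fun x => rho x * f x) by apply: annular_smoothM => //; have [] := rr.
have rhoE x : Om x -> rho x * rho x = weight p x.
  move=> Ox; rewrite /rho /weight mulrACA; congr (_ * _).
    rewrite -powRD; last by apply/implyP => _; rewrite gt_eqF ?sqnorm_Om_gt0.
    by congr (_ `^ _); field.
  rewrite -powRD; last by apply/implyP => _; rewrite gt_eqF ?log_norm_gt0.
  by congr (_ `^ _); field.
have [sg _ g2] := kg.
have cc1 : c < c + 1 by rewrite ltrDl.
have c1 : 0 < c + 1 by rewrite addr_gt0.
have G := @spectral_gap R n (c + 1) c1 gamma n2 gapE _ c cc1 sg g2.
rewrite -subr_ge0 -mulN1r /wform.
rewrite -(IntZ (-1) (annular_cc (annular_weightM p kf kA))).
rewrite -(IntD (annular_cc (annular_weightM p kA kA))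
  (ccZ (-1) (annular_cc (annular_weightM p kf kA)))).
apply: (le_trans G); rewrite le_eqVlt; apply/orP; left; apply/eqP.
congr Int; apply/funext => x.
have As : shifted gamma (fun x => rho x * f x) x = rho x * A f x.
  by rewrite /A /shifted (sph_laplacian_smoothM x rr kf); ring.
rewrite As; have [Ox|nOx] := pselect (Om x).
  by rewrite -rhoE//; ring.
have [U [oU Ux] U0] := annular_near0 kf nOx.
have [V [oV Vx] V0] := annular_near0 kA nOx.
by rewrite (U0 x) ?inE// (V0 x) ?inE//; ring.
Qed.

Lemma euler_shifted f x : annular f -> euler (A f) x = A (euler f) x.
Proof.
move=> kf; have sf := annular_smooth kf.
have sC := smooth_on_sph_laplacian oT sf.
have sg : smooth_on setT (fun x => gamma * f x).
  by apply: smooth_onM => //; exact: smooth_on_cst.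
rewrite /A /shifted (eulerD sC sg I) (eulerZ gamma sf I).
by rewrite (euler_sph_laplacian x sf).
Qed.

Lemma wform_shiftedC p u v : annular u -> annular v ->
  wform p u (A v) = wform p v (A u).
Proof.
move=> ku kv; rewrite /A /shifted.
rewrite (wformDr p (annular_sph_laplacian kv) (annularZ gamma kv) ku).
rewrite (wformDr p (annular_sph_laplacian ku) (annularZ gamma ku) kv).
rewrite (wform_sph_laplacianC p ku kv).
by rewrite (wformZr p gamma kv ku) (wformZr p gamma ku kv) (wformC p u v).
Qed.

Lemma wform_shifted_ge p u : annular u -> gamma * wform p u u <= wform p u (A u).
Proof.
move=> ku; rewrite /A /shifted.
rewrite (wformDr p (annular_sph_laplacian ku) (annularZ gamma ku) ku).
by rewrite (wformZr p gamma ku ku) lerDr; exact: wform_sph_laplacian_ge0.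
Qed.

Lemma weight_shift p x : a <= sqnorm x ->
  weight (p + 1) x = log_norm x * weight p x.
Proof.
move=> xa; have Ox : Om x by exact: lt_le_trans xa.
rewrite /weight powRD; last by apply/implyP => _; rewrite gt_eqF ?log_norm_gt0.
by rewrite powRr1 ?ltW ?log_norm_gt0//; ring.
Qed.

Lemma wform_absorb u : annular u ->
  2 * m * beta * wform (- beta - 1) u u + beta * (beta + 1) * wform (- beta - 2) u u
  <= wform (- beta) u u.
Proof.
move=> ku.
have k p := annular_cc (annular_weightM p ku ku).
rewrite /wform -(IntZ _ (k _)) -(IntZ _ (k (- beta - 2))).
rewrite -(IntD (ccZ _ (k _)) (ccZ _ (k _))).
apply: (Int_le (ccD (ccZ _ (k _)) (ccZ _ (k _))) (k _)) => x.
have [xa|ax] := ltP (sqnorm x) a.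
  by have [_ u0 _] := ku; rewrite u0// !(mul0r, mulr0) addr0.
have L := log_large ax.
have -> : - beta - 1 = (- beta - 2) + 1 by ring.
have E : weight (- beta) x = log_norm x * (log_norm x * weight (- beta - 2) x).
  rewrite -!weight_shift//; congr (weight _ x); ring.
rewrite E weight_shift//.
have W0 := weight_ge0 (- beta - 2) x.
have U0 : 0 <= u x * u x by rewrite -expr2 sqr_ge0.
have WU := mulr_ge0 W0 U0.
have mb : 0 <= m * beta by exact: mulr_ge0.
have bb : 0 <= beta * (beta + 1) by apply: mulr_ge0 => //; rewrite addr_ge0.
move: L W0 U0 WU; set t := log_norm x; set W := weight _ x; set U := u x * u x => L _ _ WU.
have -> : 2 * m * beta * (t * W * U) + beta * (beta + 1) * (W * U) =
  (2 * (m * beta) * t + beta * (beta + 1)) * (W * U) by ring.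
have -> : t * (t * W) * U = t * t * (W * U) by ring.
apply: ler_wpM2r => //.
move: L; have -> : 1 + 2 * m * beta + beta * (beta + 1) =
  1 + 2 * (m * beta) + beta * (beta + 1) by ring.
move: (m * beta) (beta * (beta + 1)) mb bb => M B M0 B0 L.
have t1 : 1 <= t by lra.
nra.
Qed.

(** Integrate the square of t E w - s w. After integrating the cross term by parts this gives the
    constant 2 s [si] - s^2, which is largest at s = [si]. *)
Lemma hardy : ((beta + 1) / 2) ^+ 2 * wform (- beta - 2) w w <=
  wform (- beta) (euler w) (euler w).
Proof.
have ke := annular_euler kw.
pose si := (beta + 1) / 2.
have := wform_euler (- beta - 1) kw kw.
rewrite (wformC _ (euler w) w).
have -> : - beta - 1 - 1 = - beta - 2 by ring.
move=> H.
have H2 : wform (- beta - 1) w (euler w) = si * wform (- beta - 2) w w.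
  by rewrite /si; lra.
suff : 0 <= wform (- beta) (euler w) (euler w) +
   (- 2 * si * wform (- beta - 1) w (euler w) + si ^+ 2 * wform (- beta - 2) w w).
  by rewrite H2 -/si; nra.
have k1 := annular_cc (annular_weightM (- beta) ke ke).
have k2 := annular_cc (annular_weightM (- beta - 1) kw ke).
have k3 := annular_cc (annular_weightM (- beta - 2) kw kw).
rewrite /wform -(IntZ _ k2) -(IntZ _ k3) -(IntD (ccZ _ k2) (ccZ _ k3)).
rewrite -(IntD k1 (ccD (ccZ _ k2) (ccZ _ k3))).
apply: Int_ge0 => x.
have [xa|ax] := ltP (sqnorm x) a.
  have [_ w0 _] := kw; have [_ e0 _] := ke.
  by rewrite w0// e0// !(mul0r, mulr0) !addr0.
have -> : - beta - 1 = (- beta - 2) + 1 by ring.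
have E : weight (- beta) x = log_norm x * (log_norm x * weight (- beta - 2) x).
  rewrite -!weight_shift//; congr (weight _ x); ring.
rewrite E weight_shift//.
have W0 := weight_ge0 (- beta - 2) x.
set W := weight _ x in W0 *; set t := log_norm x.
have -> : t * (t * W) * (euler w x * euler w x) + (-2 * si * (t * W * (w x * euler w x)) +
   si ^+ 2 * (W * (w x * w x))) = W * (t * euler w x - si * w x) ^+ 2 by ring.
by apply: mulr_ge0 => //; exact: sqr_ge0.
Qed.

Lemma weighted_rellich : 0 <= 4 * m ^+ 2 + 2 * gamma ->
  (4 * m ^+ 2 + 2 * gamma) * (((beta + 1) / 2) ^+ 2 * wform (- beta - 2) w w) <=
  wform (- beta) (fun x => euler (euler w) x + (2 * m * euler w x + -1 * A w x))
                 (fun x => euler (euler w) x + (2 * m * euler w x + -1 * A w x)).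
Proof.
move=> g0.
have ka := annular_euler kw; have kb := annular_euler ka; have kA := annular_shifted kw.
have kAa := annular_shifted ka.
have EA : euler (A w) = A (euler w) by apply/funext => x; exact: euler_shifted.
have k1 := annularZ (2 * m) ka; have k2 := annularZ (-1) kA.
have kL := annularD kb (annularD k1 k2).
rewrite (wformDl _ kb (annularD k1 k2) kL) (wformDl _ k1 k2 kL).
rewrite (wformZl _ _ ka kL) (wformZl _ _ kA kL).
rewrite (wformDr _ kb (annularD k1 k2) kb) (wformDr _ k1 k2 kb).
rewrite (wformDr _ kb (annularD k1 k2) ka) (wformDr _ k1 k2 ka).
rewrite (wformDr _ kb (annularD k1 k2) kA) (wformDr _ k1 k2 kA).
rewrite !(wformZr _ _ ka) // !(wformZr _ _ kA) //.
rewrite (wformC _ (A w) (euler w)) (wformC _ (A w) (euler (euler w))).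
rewrite (wformC _ (euler w) (euler (euler w))).
have I1 := wform_euler (- beta) ka ka.
(* I2 moves one derivative off E^2 w. The other identities evaluate products of a function with its
   own derivative, where the symmetry of A makes the two derivative terms of I3 and I4 equal. *)
have I2 := wform_euler (- beta) ka kA.
have I3 := wform_euler (- beta - 1) kw kA.
have I4 := wform_euler (- beta) kw kA.
rewrite EA in I2 I3 I4.
rewrite (wform_shiftedC _ kw ka) in I3; rewrite (wform_shiftedC _ kw ka) in I4.
rewrite (wformC _ (euler w) (euler (euler w))) in I1.
have E2 : - beta - 1 - 1 = - beta - 2 by ring.
rewrite E2 in I3.
have Z := wform_shifted_ge (- beta) ka.
have G1 := wform_gap (- beta - 1) kw.
have G2 := wform_gap (- beta - 2) kw.
have Hy := ler_wpM2l g0 hardy.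
have P1 := wform_ge0 (- beta) (euler (euler w)).
have P2 := wform_ge0 (- beta - 1) (euler w).
have Ab := wform_absorb kA.
have mb : 0 <= m * beta by exact: mulr_ge0.
have bb : 0 <= beta * (beta + 1) by apply: mulr_ge0 => //; rewrite addr_ge0.
apply: (le_trans Hy).
move: I1 I2 I3 I4 Z G1 G2 P1 P2 Ab.
move: (wform (- beta) (euler (euler w)) (euler (euler w))) => Xbb.
move: (wform (- beta) (euler w) (euler w)) => Xaa.
move: (wform (- beta) (A w) (A w)) => Xcc.
move: (wform (- beta) (euler (euler w)) (euler w)) => Xab.
move: (wform (- beta) (euler (euler w)) (A w)) => Xbc.
move: (wform (- beta) (euler w) (A (euler w))) => Z'.
move: (wform (- beta) (euler w) (A w)) => Xac.
move: (wform (- beta - 1) (euler w) (euler w)) => Yaa.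
move: (wform (- beta - 1) (euler w) (A w)) => Yac.
move: (wform (- beta - 1) w (A w)) => Ywc.
move: (wform (- beta - 1) (A w) (A w)) => Ycc.
move: (wform (- beta - 2) w (A w)) => Vwc.
move: (wform (- beta - 2) (A w) (A w)) => Vcc.
move=> I1 I2 I3 I4 Z G1 G2 P1 P2 Ab.
(* Q1 and Q2 replace w A w by (A w)^2 in the lower weights, where Ab absorbs it; Q3 and P1 discard
   the terms with E^2 w. *)
have Q1 := ler_wpM2l mb G1; have Q2 := ler_wpM2l bb G2; have Q3 := mulr_ge0 mb P2.
have R1 : Xab = beta * Yaa / 2 by lra.
have R4 : Xac = beta * Ywc / 2 by lra.
have R3 : Yac = (beta + 1) * Vwc / 2 by lra.
have R2 : Xbc = beta * ((beta + 1) * Vwc / 2) - Z' by rewrite -R3; lra.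
rewrite R1 R4 R2; lra.
Qed.

End rellich.

End weighted_forms.

(** * The substitution phi = |x|^(m + 1 - n/2) w *)

Section emden_fowler.
Context (R : realType) (n : nat).
Implicit Types (f g phi w : 'rV[R]_n -> R) (x : 'rV[R]_n).

(** The minimum is attained, so gamma = - c_j for some j, and c_k - c_j = (k - j)(n - 2 + k + j) is
    an integer, thus either at most 0 or at least 1. *)
Lemma shifted_eigenvalue_gap (alpha : R) : (2 <= n)%N -> mu_na n alpha = 0 ->
  forall k, 0 <= (sph_eigenvalue R n k + gamma_na n alpha) *
                 (sph_eigenvalue R n k + gamma_na n alpha - 1).
Proof.
move=> n2 mu0 k; have [[j _ /eqP]] := mu_na_min alpha n2.
rewrite mu0 sqrf_eq0 normr_eq0 addr_eq0 => /eqP -> _.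
rewrite /sph_eigenvalue.
have -> : k%:R * (n%:R - 2 + k%:R) + - (j%:R * (n%:R - 2 + j%:R)) =
  (k%:R - j%:R) * (n%:R - 2 + k%:R + j%:R) :> R by ring.
have n2R : 0 <= n%:R - 2 :> R by rewrite subr_ge0 (ler_nat _ 2).
have kR : 0 <= k%:R :> R := ler0n _ _.
have jR : 0 <= j%:R :> R := ler0n _ _.
have [kj|jk|->] := ltngtP k j; last by rewrite subrr !mul0r.
  have kjR : k%:R < j%:R :> R by rewrite ltr_nat.
  set z := (k%:R - j%:R) * _; have z0 : z <= 0 by apply: mulr_le0_ge0; lra.
  by apply: mulr_le0; lra.
have jkR : j%:R + 1 <= k%:R :> R by rewrite natr1 ler_nat.
set z := (k%:R - j%:R) * _; have z1 : 1 <= z by rewrite -[1]mulr1; apply: ler_pM; lra.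
by apply: mulr_ge0; lra.
Qed.

Lemma laplacian_notin_supp phi x : ~ supp phi x -> phi x = 0 /\ laplacian phi x = 0.
Proof.
move=> nsx; have oU : open (~` supp phi) by apply: closed_openC; exact: closed_closure.
have p0 y : (~` supp phi) y -> phi y = 0.
  move=> nsy; apply/eqP; apply: contrapT => /negP py; apply: nsy.
  by apply: subset_closure.
split; first exact: p0.
rewrite /laplacian big1// => i _.
rewrite (@partial_near_eq _ _ (~` supp phi) i (partial i phi) (fun=> 0) x oU nsx).
  exact: partial_cst.
move=> y; rewrite inE => nsy.
rewrite (@partial_near_eq _ _ (~` supp phi) i phi (fun=> 0) y oU nsy).
  exact: partial_cst.
by move=> z; rewrite inE; exact: p0.
Qed.

Lemma sqnorm_lt_ball x (r : R) : 0 < r -> sqnorm x < r ^+ 2 -> euclid_ball r x.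
Proof.
move=> r0 xr; rewrite /euclid_ball /= /euclid -/(sqnorm x) -(ger0_norm (ltW r0)).
by rewrite -sqrtr_sqr ltr_sqrt// exprn_gt0.
Qed.

Lemma test_function_annular phi (r : R) : 0 < r ->
  test_function (~` closure (@euclid_ball R n r)) phi ->
  exists2 c, 0 < c & annular (r ^+ 2) c phi.
Proof.
move=> r0 [sphi cphi supphi].
have [c Hc] : exists c, forall x, supp phi x -> sqnorm x <= c.
  have /compact_bounded[B [_ HB]] : compact ((@sqnorm R n) @` supp phi).
    apply: continuous_compact => //; apply: continuous_subspaceT.
    apply: smooth_on_continuousT; apply: smooth_on_sqnorm; exact: openT.
  exists (`|B| + 1) => x sx; apply: (le_trans (ler_norm _)).
  apply: HB; last by exists x.
  by rewrite (le_lt_trans (ler_norm _))// ltrDl.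
exists (`|c| + 1); first by rewrite ltr_wpDl.
split; first exact/smoothP.
- move=> x xr; apply: (laplacian_notin_supp _).1 => /supphi; apply.
  by apply: subset_closure; exact: sqnorm_lt_ball.
- move=> x cx; apply: (laplacian_notin_supp _).1 => /Hc; apply/negP.
  rewrite -ltNge (le_lt_trans _ cx)//.
  by rewrite (le_trans (ler_norm _))// lerDl.
Qed.

Lemma integral_Int M f : cc M f ->
  (\int[lebesgue_rV R n]_x (f x)%:E = (Int f)%:E)%E.
Proof.
by move=> /cc_integrable fi; rewrite /Int /Rintegral fineK//; exact: integrable_fin_num.
Qed.

Lemma integral_supported (D : set 'rV[R]_n) f : (forall x, ~ D x -> f x = 0) ->
  (\int[lebesgue_rV R n]_(x in D) (f x)%:E = \int[lebesgue_rV R n]_x (f x)%:E)%E.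
Proof.
move=> f0; rewrite integral_mkcond; apply: eq_integral => x _.
by rewrite /patch; case: ifPn => //; rewrite notin_setE => /f0 ->.
Qed.

Lemma euclid_powR x (p : R) : euclid x `^ p = sqnorm x `^ (p / 2).
Proof.
have s0 : 0 <= sqnorm x by apply: sumr_ge0 => i _; exact: sqr_ge0.
by rewrite /euclid -/(sqnorm x) -powR12_sqrt// -powRrM mulrC.
Qed.

Lemma ln_euclid x : ln (euclid x) = log_norm x.
Proof.
have s0 : 0 <= sqnorm x by apply: sumr_ge0 => i _; exact: sqr_ge0.
by rewrite /euclid -/(sqnorm x) -powR12_sqrt// ln_powR mulrC.
Qed.

Variables (a c : R).
Hypotheses (a1 : 1 < a).

Lemma annular_out f x : annular a c f -> ~ (1 < sqnorm x) -> f x = 0.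
Proof.
move=> [_ f0 _] /negP; rewrite -leNgt => /le_lt_trans/(_ a1); exact: f0.
Qed.

Lemma annular_powM (q : R) f : annular a c f -> annular a c (fun x => sqnorm x `^ q * f x).
Proof. by move=> kf; apply: annular_smoothM => //; have [] := @radial_sqnorm_powR R n q. Qed.

Lemma euler_powM (q : R) f : annular a c f ->
  euler (fun x => sqnorm x `^ q * f x) = (fun x => sqnorm x `^ q * (2 * q * f x + euler f x)).
Proof.
move=> kf; apply/funext => x.
rewrite (euler_smoothM a1 x (@radial_sqnorm_powR R n q) kf).
have [Ox|nOx] := pselect (1 < sqnorm x); last first.
  by rewrite (annular_out kf nOx) (annular_out (annular_euler kf) nOx) !mulr0 !addr0 mulr0.
have s0 : 0 < sqnorm x by exact: lt_trans Ox.
have E : sqnorm x `^ (q - 1) * sqnorm x = sqnorm x `^ q.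
  rewrite -[in X in _ * X](powRr1 (ltW s0)) -powRD ?subrK//.
  by apply/implyP => _; rewrite gt_eqF.
by rewrite -E; ring.
Qed.

(** Conjugation by |x|^s with s = 2 q replaces E by E + s. Then 2 s + n - 2 = 2 m is the coefficient
    of E, and the constant term s (s + n - 2) = m^2 - ((n - 2) / 2)^2 is - gamma. *)
Lemma laplacian_powM (m gamma : R) w x :
  gamma = ((n%:R - 2) / 2) ^+ 2 - m ^+ 2 -> annular a c w ->
  let q := (m + 1 - n%:R / 2) / 2 in
  sqnorm x * laplacian (fun x => sqnorm x `^ q * w x) x =
  sqnorm x `^ q * (euler (euler w) x + (2 * m * euler w x + -1 * shifted gamma w x)).
Proof.
move=> gE kw q.
have k1 : annular a c (fun x => 2 * q * w x + euler w x).
  by apply: annularD; [exact: annularZ|exact: annular_euler].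
have oT := @openT 'rV[R]_n.
rewrite (laplacian_polar oT (annular_smooth (annular_powM q kw)) I).
rewrite (euler_powM q kw) (euler_powM q k1).
rewrite (sph_laplacian_smoothM a1 x (@radial_sqnorm_powR R n q) kw).
have sE := annular_smooth (annular_euler kw).
have sw := annular_smooth kw.
have sZ : smooth_on setT (fun x => 2 * q * w x).
  by apply: smooth_onM => //; exact: smooth_on_cst.
rewrite (eulerD sZ sE I) (eulerZ (2 * q) sw I) /shifted gE.
have mE : m = 2 * q - 1 + n%:R / 2 by rewrite /q; field.
by rewrite mE; field.
Qed.

End emden_fowler.

(** * Return to test functions and choice of the radius *)

Lemma weighted_rellich_test (R : realType) (n : nat) (alpha beta r : R)
    (phi : 'rV[R]_n -> R) :
  (2 <= n)%N -> alpha <= 0 -> 0 <= beta -> mu_na n alpha = 0 -> 1 < r ->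
  1 + 2 * (1 - alpha / 2) * beta + beta * (beta + 1) <= ln r ->
  test_function (~` closure (@euclid_ball R n r)) phi ->
  ((2 * gamma_bar_na n alpha * ((beta + 1) / 2) ^+ 2)%:E *
     \int[lebesgue_rV R n]_(x in ~` closure (@euclid_ball R n r))
       (euclid x `^ (alpha - 4) * phi x ^+ 2 /
        ln (euclid x) `^ (beta + 2))%:E
   <= \int[lebesgue_rV R n]_(x in ~` closure (@euclid_ball R n r))
       (euclid x `^ alpha * `|laplacian phi x| ^+ 2 /
        ln (euclid x) `^ beta)%:E)%E.
Proof.
move=> n2 al0 be0 mu0 r1 logr tphi.
have r0 : 0 < r by exact: lt_trans r1.
have [c c0 kphi] := test_function_annular r0 tphi.
have [_ _ supphi] := tphi.
pose a := r ^+ 2.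
have a1 : 1 < a by rewrite /a expr2; nra.
pose m := 1 - alpha / 2.
pose gamma := gamma_na n alpha.
have gE : gamma = ((n%:R - 2) / 2) ^+ 2 - m ^+ 2.
  by rewrite /gamma /gamma_na /m; field.
have m0 : 0 <= m by rewrite /m; lra.
(* Here alpha - 4 + 4 q = - n, so the same power that conjugates the Laplacian turns both integrals
   into integrals against |x|^(-n) dx. *)
pose q := (m + 1 - n%:R / 2) / 2.
pose w x := sqnorm x `^ (- q) * phi x.
have kw : annular a c w by exact: annular_powM.
have phiE : phi = (fun x => sqnorm x `^ q * w x).
  apply/funext => x; have [Ox|nOx] := pselect (1 < sqnorm x); last first.
    by rewrite (annular_out a1 kphi nOx) (annular_out a1 kw nOx) mulr0.
  have s0 : 0 < sqnorm x by exact: lt_trans Ox.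
  rewrite /w mulrA -powRD ?subrr ?powRr0 ?mul1r//.
  by apply/implyP => _; rewrite gt_eqF.
have logl (x : 'rV[R]_n) : a <= sqnorm x -> 1 + 2 * m * beta + beta * (beta + 1) <= log_norm x.
  move=> ax; apply: (le_trans logr); rewrite /log_norm ler_pdivlMr//.
  have -> : ln r * 2 = ln (r ^+ 2) by rewrite lnXn// mulr2n; ring.
  by rewrite ler_ln ?posrE// ?exprn_gt0// (lt_le_trans _ ax)// exprn_gt0.
have gap := shifted_eigenvalue_gap n2 mu0.
have gbE : 2 * gamma_bar_na n alpha = 4 * m ^+ 2 + 2 * gamma.
  by rewrite gE /gamma_bar_na /m; field.
have gb0 : 0 <= 4 * m ^+ 2 + 2 * gamma.
  by rewrite -gbE mulr_ge0// addr_ge0 ?sqr_ge0.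
have main := weighted_rellich a1 c0 n2 m0 be0 gap kw logl gb0.
pose L x := euler (euler w) x + (2 * m * euler w x + -1 * shifted gamma w x).
have kL : annular a c L.
  apply: annularD; first by do 2 apply: annular_euler.
  apply: annularD; apply: annularZ; first exact: annular_euler.
  exact: annular_shifted.
have s0 (x : 'rV[R]_n) : 1 < sqnorm x -> 0 < sqnorm x by move=> ?; exact: lt_trans (ltr01) _.
have P (x : 'rV[R]_n) (u v : R) : 1 < sqnorm x ->
    sqnorm x `^ (u + v) = sqnorm x `^ u * sqnorm x `^ v.
  by move=> Ox; rewrite powRD//; apply/implyP => _; rewrite gt_eqF ?s0.
have F1 x : euclid x `^ (alpha - 4) * phi x ^+ 2 / ln (euclid x) `^ (beta + 2) =
    weight (- beta - 2) x * (w x * w x).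
  have [Ox|nOx] := pselect (1 < sqnorm x); last first.
    by rewrite (annular_out a1 kphi nOx) (annular_out a1 kw nOx) expr0n !(mulr0, mul0r).
  rewrite euclid_powR ln_euclid -powRN /weight [in LHS]phiE.
  have -> : - (n%:R / 2) = (alpha - 4) / 2 + q + q by rewrite /q /m; field.
  rewrite !P//; have -> : - (beta + 2) = - beta - 2 by ring.
  by ring.
have F2 x : euclid x `^ alpha * `|laplacian phi x| ^+ 2 / ln (euclid x) `^ beta =
    weight (- beta) x * (L x * L x).
  have lapE : sqnorm x * laplacian phi x = sqnorm x `^ q * L x.
    by rewrite {1}phiE; exact: (laplacian_powM a1 x gE kw).
  have [Ox|nOx] := pselect (1 < sqnorm x); last first.
    have -> : laplacian phi x = 0.
      apply: (laplacian_notin_supp _).2 => /supphi; apply.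
      apply: subset_closure; apply: sqnorm_lt_ball => //.
      by move: nOx => /negP; rewrite -leNgt => /le_lt_trans; apply.
    by rewrite (annular_out a1 kL nOx) normr0 expr0n !(mulr0, mul0r).
  rewrite real_normK ?num_real// euclid_powR ln_euclid -powRN /weight.
  have lE : laplacian phi x = sqnorm x `^ (q - 1) * L x.
    apply: (@mulfI _ (sqnorm x)); first by rewrite gt_eqF ?s0.
    rewrite lapE mulrA; congr (_ * _).
    by rewrite -[X in X * _](powRr1 (ltW (s0 _ Ox))) -P//; congr (_ `^ _); ring.
  rewrite lE.
  have -> : - (n%:R / 2) = alpha / 2 + (q - 1) + (q - 1) by rewrite /q /m; field.
  by rewrite !P//; ring.
have E1 := integral_Int (annular_cc (annular_weightM a1 (- beta - 2) kw kw)).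
have E2 := integral_Int (annular_cc (annular_weightM a1 (- beta) kL kL)).
have out x : ~ (~` closure (@euclid_ball R n r)) x -> phi x = 0 /\ laplacian phi x = 0.
  by move=> nDx; apply: laplacian_notin_supp => /supphi.
have S1 := @integral_supported R n (~` closure (@euclid_ball R n r))
  (fun x => weight (- beta - 2) x * (w x * w x)).
have S2 := @integral_supported R n (~` closure (@euclid_ball R n r))
  (fun x => weight (- beta) x * (L x * L x)).
under eq_integral do rewrite F1.
under [X in (_ <= X)%E]eq_integral do rewrite F2.
rewrite S1; last first.
  by move=> x /out[p0 _]; rewrite -F1 p0 expr0n mulr0 mul0r.
rewrite S2; last first.
  by move=> x /out[_ p0]; rewrite -F2 p0 normr0 expr0n mulr0 mul0r.
rewrite E1 E2 -EFinM lee_fin gbE -mulrA.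
exact: main.
Qed.

Unset Implicit Arguments.

Theorem theorem4p1 (R : realType) (n : nat) (alpha beta : R) :
  (2 <= n)%N -> alpha <= 0 -> 0 <= beta -> mu_na n alpha = 0 ->
  exists r : R, 1 < r /\
    forall phi : 'rV[R]_n -> R,
      test_function (~` closure (@euclid_ball R n r)) phi ->
      ((2 * gamma_bar_na n alpha * ((beta + 1) / 2) ^+ 2)%:E *
         \int[lebesgue_rV R n]_(x in ~` closure (@euclid_ball R n r))
           (euclid x `^ (alpha - 4) * phi x ^+ 2 /
            ln (euclid x) `^ (beta + 2))%:E
       <= \int[lebesgue_rV R n]_(x in ~` closure (@euclid_ball R n r))
           (euclid x `^ alpha * `|laplacian phi x| ^+ 2 /
            ln (euclid x) `^ beta)%:E)%E.
Proof.
move=> n2 al0 be0 mu0.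
(* The lower bound for log |x| in [log_large], with m = 1 - alpha / 2; the radius e^T depends only
   on alpha and beta. *)
pose T := 1 + 2 * (1 - alpha / 2) * beta + beta * (beta + 1).
have T0 : 0 < T by rewrite /T; nra.
exists (expR T); split; first by rewrite expR_gt1.
move=> phi tphi; apply: weighted_rellich_test => //; first by rewrite expR_gt1.
by rewrite expRK.
Qed.
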